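(* Let $m,n$ be positive integers, let $L$ be a broken line in $M_{m,n}(\mathbb{Z}_+)$ and let $M\in\mathcal{C}_L^-$. The quantum minor $M$ generates a completely prime ideal of $\mathcal{O}_q(T_L\cup L)$. Specifically, it satisfies the following property: if $p_1M=p_2p_3$ in $\mathcal{O}_q(T_L\cup L)$, with $p_1,p_2,p_3\in\mathcal{O}_q(T_L\cup L)$, then $p_2=p_4M$ or $p_3=p_5M$ for some $p_4,p_5\in\mathcal{O}_q(T_L\cup L)$.
   Context: $K=\mathbb{Q}(q)$. $\mathcal{O}_q(M(m,n))$ is the associative $K$-algebra generated by $Z_{i,j}$ ($1\le i\le m$, $1\le j\le n$) with relations $Z_{ij}Z_{ik}=q^2Z_{ik}Z_{ij}$ if $j<k$; $Z_{ij}Z_{kj}=q^2Z_{kj}Z_{ij}$ if $i<k$; $Z_{ij}Z_{st}=Z_{st}Z_{ij}$ if $i>s,\ j<t$; $Z_{ij}Z_{st}=Z_{st}Z_{ij}+(q^2-q^{-2})Z_{it}Z_{sj}$ if $i<s,\ j<t$. For $I=\{i_1<\dots<i_r\}$ (rows), $J=\{j_1<\dots<j_r\}$ (columns), $\xi^I_J=\sum_{\sigma\in S_r}(-q^2)^{\ell(\sigma)}Z_{i_1,j_{\sigma(1)}}\cdots Z_{i_r,j_{\sigma(r)}}$ is a quantum minor, solid if $I,J$ consist of consecutive integers. A broken line $L$ in $M_{m,n}(\mathbb{Z}_+)$ is a lattice path from $(1,n)$ to $(m,1)$ each of whose unit steps lowers the column number by 1 or raises the row number by 1; it is identified with its set of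 lattice points. Every diagonal $\{i-j=\text{const}\}$ of the $m\times n$ rectangle meets $L$ exactly once. $T_L$ (points below $L$) consists of those $(i,j)\notin L$ with $(i-t,j-t)\in L$ for some $t>0$. $\mathcal{O}_q(T_L\cup L)$ is the subalgebra of $\mathcal{O}_q(M(m,n))$ generated by the $Z_{i,j}$ with $(i,j)\in T_L\cup L$. $\mathcal{C}_L^-$ is the set of the $m+n-1$ quantum minors obtained as follows: for each point $(i,j)$ with $i=m$ or $j=n$, take the biggest solid quantum minor with bottom right corner $(i,j)$ completely contained in $T_L\cup L$. *)

(* Defs.v *)
From HB Require Import structures.
From mathcomp Require Import all_boot all_order all_algebra all_fingroup.
From mathcomp Require Import generic_quotient.
From mathcomp Require Import boolp.
From mathcomp Require Import finmap.
From mathcomp.multinomials Require Import monalg.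

Set Implicit Arguments.
Unset Strict Implicit.
Unset Printing Implicit Defensive.

Import GRing.Theory.
Local Open Scope ring_scope.
Local Open Scope quotient_scope.

(* Two-sided ideals of a possibly noncommutative ring. Ideals and subalgebras *)
(* generated by a family are intersections; since they need not be decidable, *)
(* they are made boolean predicates with the classical `[< _ >].              *)

Definition two_sided_ideal (R : pzRingType) (I : {pred R}) : Prop :=
  [/\ zmod_closed I,
      forall a x, x \in I -> a * x \in I
    & forall a x, x \in I -> x * a \in I].

Definition ideal_gen (R : pzRingType) (X : R -> Prop) : {pred R} :=
  fun x => `[< forall I : {pred R}, two_sided_ideal I ->
                 (forall y, X y -> y \in I) -> x \in I >].

Definition completely_prime (R : pzRingType) (P : {pred R}) : Prop :=
  [/\ two_sided_ideal P, 1 \notin P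
    & forall a b, a * b \in P -> a \in P \/ b \in P].

Lemma ideal_gen_ideal (R : pzRingType) (X : R -> Prop) :
  two_sided_ideal (ideal_gen X).
Proof.
split=> [|a x /asboolP hx|a x /asboolP hx].
- split=> [|x y /asboolP hx /asboolP hy]; apply/asboolP=> I hI XI.
    by case: hI => -[].
  by case: (hI) => -[_ hB _ _]; apply: hB; [apply: hx|apply: hy].
- by apply/asboolP=> I hI XI; case: (hI) => _ hl _; apply/hl/hx.
- by apply/asboolP=> I hI XI; case: (hI) => _ _ hr; apply/hr/hx.
Qed.

Definition subalg_gen (F : fieldType) (A : algType F) (X : A -> Prop) :
    {pred A} :=
  fun x => `[< forall S : {pred A}, GRing.subalg_closed S ->
                 (forall y, X y -> y \in S) -> x \in S >].

Section SubAlgebra.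
Variables (F : fieldType) (A : algType F) (X : A -> Prop).

Lemma subalg_gen_closed : GRing.subalg_closed (subalg_gen X).
Proof.
split=> [|a x y /asboolP hx /asboolP hy|x y /asboolP hx /asboolP hy];
  apply/asboolP=> S hS XS; case: (hS) => h1 hL hM //.
- by apply: hL; [apply: hx|apply: hy].
- by apply: hM; [apply: hx|apply: hy].
Qed.

Lemma mem_subalg_gen x : X x -> x \in subalg_gen X.
Proof. by move=> Xx; apply/asboolP=> S _; apply. Qed.

HB.instance Definition _ :=
  GRing.isSubalgClosed.Build F A (subalg_gen X)
  (GRing.subalg_closed_semi subalg_gen_closed).

Record subalg := SubAlg { subalg_val : A; _ : subalg_val \in subalg_gen X }.

HB.instance Definition _ := [isSub for subalg_val].
HB.instance Definition _ := [Choice of subalg by <:].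
HB.instance Definition _ := [SubChoice_isSubAlgebra of subalg by <:].

End SubAlgebra.

(* MathComp's {ideal_quot _} is restricted to commutative rings. *)
Section QuotientAlgebra.
Variables (F : fieldType) (A : algType F) (I : {pred A}).
Hypotheses (idealI : two_sided_ideal I) (properI : 1 \notin I).

Definition congr_mod (x y : A) : bool := (x - y) \in I.

Let I0 : 0 \in I. Proof. by case: idealI => -[]. Qed.
Let IB x y : x \in I -> y \in I -> x - y \in I.
Proof. by case: idealI => -[_ h _ _]; apply: h. Qed.
Let IN x : x \in I -> - x \in I.
Proof. by move=> Ix; rewrite -sub0r IB. Qed.
Let ID x y : x \in I -> y \in I -> x + y \in I.
Proof. by move=> Ix Iy; rewrite -[y]opprK IB ?IN. Qed.
Let IMl a x : x \in I -> a * x \in I.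
Proof. by case: idealI => _ h _; apply: h. Qed.
Let IMr a x : x \in I -> x * a \in I.
Proof. by case: idealI => _ _; apply. Qed.

Lemma congr_mod_equiv : equiv_class_of congr_mod.
Proof.
split=> [x|x y|y x z]; rewrite /congr_mod ?subrr //.
  by apply/idP/idP => /IN; rewrite opprB.
by move=> hxy hyz; rewrite -(subrKA y); apply: ID.
Qed.

Canonical congr_mod_rel := EquivRelPack congr_mod_equiv.

Definition quot_alg_of (_ : 1 \notin I) := {eq_quot congr_mod}.
Local Notation Q := (quot_alg_of properI).

HB.instance Definition _ := EqQuotient.on Q.
HB.instance Definition _ := Choice.on Q.

Definition qzero : Q := lift_cst Q 0.
Definition qone : Q := lift_cst Q 1.
Definition qopp := lift_op1 Q -%R.
Definition qadd := lift_op2 Q +%R.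
Definition qmul := lift_op2 Q *%R.
Definition qscale (a : F) := lift_op1 Q ( *:%R a).

Canonical pi_qzero_morph := PiConst qzero.
Canonical pi_qone_morph := PiConst qone.

Let congrP x y : reflect (\pi_Q x = \pi_Q y) (x - y \in I).
Proof. by apply: (iffP (@generic_quotient.eqmodP A congr_mod_rel x y)); rewrite ?unlock. Qed.

Let reprB x : x - repr (\pi_Q x) \in I.
Proof. by apply/congrP; rewrite reprK. Qed.

Lemma pi_qopp : {morph \pi_Q : x / - x >-> qopp x}.
Proof.
move=> x; unlock qopp; apply/congrP.
by rewrite -opprD; apply/IN/reprB.
Qed.
Canonical pi_qopp_morph := PiMorph1 pi_qopp.

Lemma pi_qadd : {morph \pi_Q : x y / x + y >-> qadd x y}.
Proof.
move=> x y; unlock qadd; apply/congrP.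
by rewrite opprD addrACA; apply: ID; apply: reprB.
Qed.
Canonical pi_qadd_morph := PiMorph2 pi_qadd.

Lemma pi_qmul : {morph \pi_Q : x y / x * y >-> qmul x y}.
Proof.
move=> x y; unlock qmul; apply/congrP.
rewrite -(subrKA (repr (\pi_Q x) * y)) -mulrBl -mulrBr.
by apply: ID; [apply/IMr/reprB|apply/IMl/reprB].
Qed.
Canonical pi_qmul_morph := PiMorph2 pi_qmul.

Lemma pi_qscale a : {morph \pi_Q : x / a *: x >-> qscale a x}.
Proof.
move=> x; unlock qscale; apply/congrP.
by rewrite -scalerBr -mulr_algl; apply/IMl/reprB.
Qed.
Canonical pi_qscale_morph a := PiMorph1 (pi_qscale a).

Let qaddA : associative qadd.
Proof. by elim/quotW=> x; elim/quotW=> y; elim/quotW=> z; rewrite !piE addrA. Qed.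
Let qaddC : commutative qadd.
Proof. by elim/quotW=> x; elim/quotW=> y; rewrite !piE addrC. Qed.
Let qadd0 : left_id qzero qadd.
Proof. by elim/quotW=> x; rewrite !piE add0r. Qed.
Let qaddN : left_inverse qzero qopp qadd.
Proof. by elim/quotW=> x; rewrite !piE addNr. Qed.

HB.instance Definition _ := GRing.isZmodule.Build Q qaddA qaddC qadd0 qaddN.

Let qmulA : associative qmul.
Proof. by elim/quotW=> x; elim/quotW=> y; elim/quotW=> z; rewrite !piE mulrA. Qed.
Let qmul1l : left_id qone qmul.
Proof. by elim/quotW=> x; rewrite !piE mul1r. Qed.
Let qmul1r : right_id qone qmul.
Proof. by elim/quotW=> x; rewrite !piE mulr1. Qed.
Let qmulDl : left_distributive qmul qadd.
Proof. by elim/quotW=> x; elim/quotW=> y; elim/quotW=> z; rewrite !piE mulrDl. Qed.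
Let qmulDr : right_distributive qmul qadd.
Proof. by elim/quotW=> x; elim/quotW=> y; elim/quotW=> z; rewrite !piE mulrDr. Qed.
Let qone_neq0 : qone != qzero.
Proof. by rewrite !piE /= /congr_mod subr0 (negbTE properI). Qed.

HB.instance Definition _ := GRing.Zmodule_isNzRing.Build Q
  qmulA qmul1l qmul1r qmulDl qmulDr qone_neq0.

Let qscaleA a b v : qscale a (qscale b v) = qscale (a * b) v.
Proof. by elim/quotW: v => x; rewrite !piE scalerA. Qed.
Let qscale1 : left_id 1 qscale.
Proof. by elim/quotW=> x; rewrite !piE scale1r. Qed.
Let qscaleDr : right_distributive qscale qadd.
Proof. by move=> a; elim/quotW=> x; elim/quotW=> y; rewrite !piE scalerDr. Qed.
Let qscaleDl v : {morph qscale^~ v : a b / a + b >-> qadd a b}.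
Proof. by elim/quotW: v => x a b; rewrite !piE scalerDl. Qed.

HB.instance Definition _ := GRing.Zmodule_isLmodule.Build F Q
  qscaleA qscale1 qscaleDr qscaleDl.

Let qscaleAl a (u v : Q) : a *: (u * v) = (a *: u) * v.
Proof.
elim/quotW: u => x; elim/quotW: v => y.
by rewrite /GRing.mul /GRing.scale /= !piE scalerAl.
Qed.

HB.instance Definition _ := GRing.Lmodule_isLalgebra.Build F Q qscaleAl.

Let qscaleAr a (u v : Q) : a *: (u * v) = u * (a *: v).
Proof.
elim/quotW: u => x; elim/quotW: v => y.
by rewrite /GRing.mul /GRing.scale /= !piE scalerAr.
Qed.

HB.instance Definition _ := GRing.Lalgebra_isAlgebra.Build F Q qscaleAr.

End QuotientAlgebra.

Definition free_alg (F : fieldType) (T : choiceType) := {malg F[{fmonom T}]}.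

HB.instance Definition _ (F : fieldType) (T : choiceType) :=
  GRing.Lalgebra.on (free_alg F T).

Lemma free_alg_scalerAr (F : fieldType) (T : choiceType) (a : F)
  (x y : free_alg F T) : a *: (x * y) = x * (a *: y).
Proof.
apply/malgP=> u; rewrite [LHS]mcoeffZ [in LHS]mcoeffMl mulr_sumr.
rewrite [RHS](mcoeffMlw u (fsubset_refl _) (msuppZ_le a y)).
apply: eq_bigr=> v _; rewrite mulr_sumr; apply: eq_bigr=> w _.
by rewrite mcoeffZ mulrnAr mulrCA.
Qed.

HB.instance Definition _ (F : fieldType) (T : choiceType) :=
  GRing.Lalgebra_isAlgebra.Build F (free_alg F T) (@free_alg_scalerAr F T).

HB.lock Definition free_gen (F : fieldType) (T : choiceType) (t : T) :
  free_alg F T := << fmu t >>.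

(* Rows and columns are indexed from 0. *)
Section QuantumMatrices.
Variables (F : fieldType) (q : F) (m n : nat).

Local Notation freeX i j := (free_gen F (i, j)).

(* Each relation u = v is recorded as the element u - v of the free algebra. *)
Inductive qmat_relator : free_alg F ('I_m * 'I_n)%type -> Prop :=
| RelRow (i : 'I_m) (j k : 'I_n) of (j < k)%N :
    qmat_relator (freeX i j * freeX i k - q ^+ 2 *: (freeX i k * freeX i j))
| RelCol (i k : 'I_m) (j : 'I_n) of (i < k)%N :
    qmat_relator (freeX i j * freeX k j - q ^+ 2 *: (freeX k j * freeX i j))
| RelAnti (i s : 'I_m) (j t : 'I_n) of (s < i)%N & (j < t)%N :
    qmat_relator (freeX i j * freeX s t - freeX s t * freeX i j)
| RelDiag (i s : 'I_m) (j t : 'I_n) of (i < s)%N & (j < t)%N :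
    qmat_relator (freeX i j * freeX s t
      - (freeX s t * freeX i j + (q ^+ 2 - q ^- 2) *: (freeX i t * freeX s j))).

Lemma qmat_ideal_proper : 1 \notin ideal_gen qmat_relator.
Proof.
pose A := free_alg F ('I_m * 'I_n)%type.
have [f [f1 fM] [fB [fZ fX]]] : exists2 f : A -> F,
    f 1 = 1 /\ (forall x y, f (x * y) = f x * f y)
  & (forall x y, f (x - y) = f x - f y) /\ (forall a x, f (a *: x) = a * f x)
    /\ forall i j, f (freeX i j) = 0.
  exists (mcoeff (@mone _)).
    by case: (mcoeff1g_is_multiplicative {fmonom ('I_m * 'I_n)%type} F).
  split=> [x y|]; first exact: mcoeffB.
  by split=> [a x|i j]; [exact: mcoeffZ|rewrite unlock mcoeffU1 fm1_eq1].
have add_f x y : f x = 0 -> f y = 0 -> f (x + y) = 0.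
  have := fB (x + y) y; rewrite addrK => -> fx fy.
  by move: fx; rewrite fy subr0.
pose I : {pred A} := fun x => f x == 0.
have inI x : (x \in I) = (f x == 0) by [].
have I1 : 1 \notin I by rewrite inI f1 oner_eq0.
have sub_I x y : f x = 0 -> f y = 0 -> x - y \in I.
  by rewrite inI fB => -> ->; rewrite subr0.
have fXX i j s t : f (freeX i j * freeX s t) = 0 by rewrite fM fX mul0r.
clearbody I; move: I1; apply: contraNN => /asboolP; apply=> [|_ []]; last 4 first.
- by move=> *; apply: sub_I; rewrite ?fZ fXX ?mulr0.
- by move=> *; apply: sub_I; rewrite ?fZ fXX ?mulr0.
- by move=> *; apply: sub_I; rewrite fXX.
- move=> i s j t _ _; apply: sub_I; first exact: fXX.
  by apply: add_f; [exact: fXX|rewrite fZ fXX mulr0].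
split=> [|a x|a x].
- split=> [|x y]; rewrite !inI; first by rewrite -(subrr 0) fB subrr.
  by rewrite fB => /eqP-> /eqP->; rewrite subr0.
- by rewrite !inI fM => /eqP->; rewrite mulr0.
- by rewrite !inI fM => /eqP->; rewrite mul0r.
Qed.

Definition Oq := quot_alg_of (ideal_gen_ideal qmat_relator) qmat_ideal_proper.

HB.instance Definition _ := GRing.Algebra.on Oq.

Definition Z (i : 'I_m) (j : 'I_n) : Oq := \pi_Oq (freeX i j).

Definition perm_length r (s : 'S_r) : nat :=
  #|[set p : 'I_r * 'I_r | (p.1 < p.2)%N && (s p.2 < s p.1)%N]|.

(* A set of r rows (columns) is given by its increasing enumeration I (J); in *)
(* C_minus below, increasingness follows from [consecutive].                  *)
Definition qminor r (I : 'I_r -> 'I_m) (J : 'I_r -> 'I_n) : Oq :=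
  \sum_(s : 'S_r)
    (- q ^+ 2) ^+ perm_length s *: \prod_(k < r) Z (I k) (J (s k)).

Definition unit_step (p p' : 'I_m * 'I_n) : bool :=
  ((p'.1 == p.1) && (p'.2.+1 == p.2 :> nat))
  || ((p'.1 == p.1.+1 :> nat) && (p'.2 == p.2)).

Definition broken_line (L : {set 'I_m * 'I_n}) : Prop :=
  exists (p : 'I_m * 'I_n) (s : seq ('I_m * 'I_n)),
    [/\ path unit_step p s,
        p.1 = 0%N :> nat /\ p.2.+1 = n,
        (last p s).1.+1 = m /\ (last p s).2 = 0%N :> nat
      & L = [set x in p :: s]].

(* $T_L$. The shift t can be taken in 'I_m since t <= p.1 < m.               *)
Definition below (L : {set 'I_m * 'I_n}) : {set 'I_m * 'I_n} :=
  [set p | (p \notin L) &&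
    [exists l in L, [exists t : 'I_m,
      [&& (0 < t)%N, p.1 == (l.1 + t)%N :> nat & p.2 == (l.2 + t)%N :> nat]]]].

Definition region_gens (L : {set 'I_m * 'I_n}) (x : Oq) : Prop :=
  exists2 p, p \in below L :|: L & x = Z p.1 p.2.

Definition Oq_region (L : {set 'I_m * 'I_n}) := subalg (region_gens L).

HB.instance Definition _ L := GRing.Algebra.on (Oq_region L).
HB.instance Definition _ L := SubChoice.on (Oq_region L).

Definition consecutive r d (f : 'I_r -> 'I_d) : Prop :=
  forall k l : 'I_r, l = k.+1 :> nat -> f l = (f k).+1 :> nat.

Definition solid_in_region (L : {set 'I_m * 'I_n}) (i : 'I_m) (j : 'I_n)
    r (I : 'I_r -> 'I_m) (J : 'I_r -> 'I_n) : Prop :=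
  [/\ (0 < r)%N, consecutive I, consecutive J,
      forall k : 'I_r, k.+1 = r -> I k = i /\ J k = j
    & forall k l : 'I_r, (I k, J l) \in below L :|: L].

(* The corner (i, j) lies on the last row or the last column, and r is the    *)
(* largest size of a solid minor with that corner inside the region.          *)
Definition C_minus (L : {set 'I_m * 'I_n}) (M : Oq) : Prop :=
  exists (i : 'I_m) (j : 'I_n) r (I : 'I_r -> 'I_m) (J : 'I_r -> 'I_n),
    [/\ i.+1 = m \/ j.+1 = n,
        solid_in_region L i j I J,
        forall r' (I' : 'I_r' -> 'I_m) (J' : 'I_r' -> 'I_n),
          solid_in_region L i j I' J' -> (r' <= r)%N
      & M = qminor I J].

Lemma C_minus_region L M : C_minus L M -> M \in subalg_gen (region_gens L).
Proof.
case=> i [j] [r] [I] [J] [_ [_ _ _ _ hL] _ ->].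
apply: rpred_sum => s _; apply: rpredZ; apply: rpred_prod => k _.
by apply: mem_subalg_gen; exists (I k, J (s k)).
Qed.

End QuantumMatrices.

(* The ground field $\mathbb{Q}(q)$ and its variable. *)
Definition Qq : fieldType := {fraction {poly rat}}.
Definition qvar : Qq := tofrac 'X.

(* Main.v *)
Require Import Defs.
From HB Require Import structures.
From mathcomp Require Import all_boot all_order all_algebra all_fingroup.
From mathcomp Require Import generic_quotient boolp functions.
From mathcomp.multinomials Require Import monalg.
From mathcomp Require Import zify ring.

(** Write [p = q ^+ 2]. The region [U] formed by [T_L] and [L] is an up-set of
    the grid ([region_up_set]), and the minors in question are those of the
    square boxes in [U] that touch the last row or the last column and cannot be
    enlarged towards the north-west ([C_minus_corner_box]). Let [M] be such a
    minor and let [A U] be the algebra of the region.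

    The point of the choice of [M] is that every generator of [A U] commutes
    with [M] up to a power of [p] ([minor_normal]): the only grid points for
    which this fails lie strictly north-west or strictly south-east of the box,
    and there are none of these in [U]. So the ideal of [M] is [A U * M], and
    both claims say that [M] is a prime element: if [M] divides a product from
    the right, it divides a factor ([prime_element]). The commutation rule is
    clear for the generators at the corners north-east and south-west of the
    box, where it holds for each monomial of [M] separately. It is carried along
    rows and columns by skew derivations that move a row or column onto a
    neighbour; they kill [M], since the terms of the minor cancel in pairs
    ([col_killed], [row_killed], [skew_transfer]).

    Primality is proved by induction on [U] ([region_prime]). Let [x] be the
    generator at the first point of [U] in lexicographic order and let [V] be the
    rest of [U], again an up-set. Then [A U] is an Ore extension of [A V]: every
    element is uniquely a sum of terms [x ^+ i * b] with [b] in [A V], and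
    [b * x - x * tau b] lies in [A V] for an automorphism [tau] that rescales the
    generators. If the point of [x] is not the corner of the box, then [M] lies
    in [A V], and a look at leading coefficients shows that [M] stays prime
    ([prime_element_extend]). If it is the corner, expansion along the first row
    gives [M = x * N + c] with [c] in [A V], where [N] is the minor of the box
    without its first row and column; [N] is prime in [A V] by induction. After
    inverting [N] one can solve [M = 0] for [x], so that the quotient by [M]
    becomes a localisation of the domain [A V]. It remains to see that
    [N] is regular modulo [M], and this comes down to [c] not being a multiple of
    [N] ([prime_element_adjoin]).

    Two representations supply what cannot be read off from the relations. Both
    come from the fact that the product of two quantum matrices with commuting
    entries is a quantum matrix ([product_qmx]), applied to 2 x 2 blocks of
    q-oscillators. One oscillator for each grid point gives a module with one
    basis vector per ordered monomial, on which the generators act as left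
    multiplications ([fock_module]); it yields the uniqueness of the
    coefficients of the powers of [x]. A single oscillator at the corner of the
    box gives a module with a vector that is killed by [N] but not by [c]
    ([tail_not_multiple]). *)

Set Implicit Arguments.
Unset Strict Implicit.
Unset Printing Implicit Defensive.

Import GRing.Theory.
Local Open Scope ring_scope.
Local Open Scope quotient_scope.

(** * The algebra of endomorphisms *)

Section Endomorphisms.
Variables (F : fieldType) (W : lmodType F) (w0 : W).

(** The nonzero vector [w0] makes the ring nontrivial, as [algType] demands. *)
Record endo (nzW : w0 != 0) := Endo { endo_fun :> W -> W;
  endo_lin : linear endo_fun }.

Variable nzW : w0 != 0.
Local Notation E := (endo nzW).

HB.instance Definition _ := gen_eqMixin E.
HB.instance Definition _ := gen_choiceMixin E.

Lemma endoP (f g : E) : (forall w, f w = g w) -> f = g.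
Proof.
case: f => f lf; case: g => g lg /= /funext fg; move: lg; rewrite -fg => lg.
by rewrite (Prop_irrelevance lf lg).
Qed.

Lemma endoL (f : E) a u v : f (a *: u + v) = a *: f u + f v.
Proof. exact: endo_lin. Qed.
Lemma endoD (f : E) u v : f (u + v) = f u + f v.
Proof. by rewrite -[u in LHS]scale1r endoL scale1r. Qed.
Lemma endo0 (f : E) : f 0 = 0.
Proof. by apply: (addIr (f 0)); rewrite -endoD !add0r. Qed.
Lemma endoZ (f : E) a u : f (a *: u) = a *: f u.
Proof. by rewrite -[a *: u]addr0 endoL endo0 addr0. Qed.
Fact endo_zero_lin : linear (fun _ : W => 0 : W).
Proof. by move=> a u v; rewrite scaler0 addr0. Qed.
Fact endo_one_lin : linear (fun w : W => w).
Proof. by []. Qed.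
Fact endo_opp_lin (f : E) : linear (fun w => - f w).
Proof. by move=> a u v; rewrite endoL opprD scalerN. Qed.
Fact endo_add_lin (f g : E) : linear (fun w => f w + g w).
Proof. by move=> a u v; rewrite !endoL scalerDr addrACA. Qed.
Fact endo_mul_lin (f g : E) : linear (fun w => f (g w)).
Proof. by move=> a u v; rewrite !endoL. Qed.
Fact endo_scale_lin (c : F) (f : E) : linear (fun w => c *: f w).
Proof. by move=> a u v; rewrite endoL scalerDr !scalerA mulrC. Qed.

Definition endo_zero : E := Endo nzW endo_zero_lin.
Definition endo_one : E := Endo nzW endo_one_lin.
Definition endo_opp f : E := Endo nzW (endo_opp_lin f).
Definition endo_add f g : E := Endo nzW (endo_add_lin f g).
Definition endo_mul f g : E := Endo nzW (endo_mul_lin f g).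
Definition endo_scale c f : E := Endo nzW (endo_scale_lin c f).

Fact endo_addA : associative endo_add.
Proof. by move=> f g h; apply: endoP => w /=; rewrite addrA. Qed.
Fact endo_addC : commutative endo_add.
Proof. by move=> f g; apply: endoP => w /=; rewrite addrC. Qed.
Fact endo_add0 : left_id endo_zero endo_add.
Proof. by move=> f; apply: endoP => w /=; rewrite add0r. Qed.
Fact endo_addN : left_inverse endo_zero endo_opp endo_add.
Proof. by move=> f; apply: endoP => w /=; rewrite addNr. Qed.
HB.instance Definition _ :=
  GRing.isZmodule.Build E endo_addA endo_addC endo_add0 endo_addN.

Fact endo_mulA : associative endo_mul.
Proof. by move=> f g h; apply: endoP. Qed.
Fact endo_mul1l : left_id endo_one endo_mul.
Proof. by move=> f; apply: endoP. Qed.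
Fact endo_mul1r : right_id endo_one endo_mul.
Proof. by move=> f; apply: endoP. Qed.
Fact endo_mulDl : left_distributive endo_mul endo_add.
Proof. by move=> f g h; apply: endoP. Qed.
Fact endo_mulDr : right_distributive endo_mul endo_add.
Proof. by move=> f g h; apply: endoP => w /=; rewrite endoD. Qed.
Fact endo_one_neq0 : endo_one != 0.
Proof.
by apply: contraNN nzW => /eqP /(congr1 (fun f : E => f w0)) /= ->.
Qed.
HB.instance Definition _ := GRing.Zmodule_isNzRing.Build E
  endo_mulA endo_mul1l endo_mul1r endo_mulDl endo_mulDr endo_one_neq0.

Fact endo_scaleA a b f : endo_scale a (endo_scale b f) = endo_scale (a * b) f.
Proof. by apply: endoP => w /=; rewrite scalerA. Qed.
Fact endo_scale1 : left_id 1 endo_scale.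
Proof. by move=> f; apply: endoP => w /=; rewrite scale1r. Qed.
Fact endo_scaleDr : right_distributive endo_scale +%R.
Proof. by move=> a f g; apply: endoP => w /=; rewrite scalerDr. Qed.
Fact endo_scaleDl f : {morph endo_scale^~ f : a b / a + b}.
Proof. by move=> a b; apply: endoP => w /=; rewrite scalerDl. Qed.
HB.instance Definition _ := GRing.Zmodule_isLmodule.Build F E
  endo_scaleA endo_scale1 endo_scaleDr endo_scaleDl.

Fact endo_scaleAl a (f g : E) : a *: (f * g) = (a *: f) * g.
Proof. exact: endoP. Qed.
HB.instance Definition _ := GRing.Lmodule_isLalgebra.Build F E endo_scaleAl.
Fact endo_scaleAr a (f g : E) : a *: (f * g) = f * (a *: g).
Proof. by apply: endoP => w /=; rewrite endoZ. Qed.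
HB.instance Definition _ := GRing.Lalgebra_isAlgebra.Build F E endo_scaleAr.

Lemma endo_addE (f g : E) w : (f + g) w = f w + g w. Proof. by []. Qed.
Lemma endo_mulE (f g : E) w : (f * g) w = f (g w). Proof. by []. Qed.
Lemma endo_zeroE w : (0 : E) w = 0. Proof. by []. Qed.
Lemma endo_oneE w : (1 : E) w = w. Proof. by []. Qed.
Lemma endo_oppE (f : E) w : (- f) w = - f w. Proof. by []. Qed.
Lemma endo_scaleE c (f : E) w : (c *: f) w = c *: f w. Proof. by []. Qed.
Lemma endo_sumE I (r : seq I) P (G : I -> E) w :
  (\sum_(i <- r | P i) G i) w = \sum_(i <- r | P i) G i w.
Proof. by elim/big_rec2: _ => // i u v _ <-. Qed.

End Endomorphisms.

Definition endoE := (endo_addE, endo_mulE, endo_zeroE, endo_oneE, endo_oppE,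
  endo_scaleE).

(** * Representations from the defining relations *)

Section Presentation.
Variables (F : fieldType) (q : F) (m n : nat).
Local Notation O := (Oq q m n).
Local Notation p := (q ^+ 2).
Local Notation Z := (Z q).

Local Notation A := (free_alg F ('I_m * 'I_n)%type).
Local Notation idI := (ideal_gen_ideal (@qmat_relator F q m n)).
Local Notation pr1 := (qmat_ideal_proper q m n).

Lemma piD (x y : A) : \pi_O (x + y) = \pi_O x + \pi_O y.
Proof. exact: (pi_qadd idI). Qed.
Lemma piM (x y : A) : \pi_O (x * y) = \pi_O x * \pi_O y.
Proof. exact: (pi_qmul idI). Qed.
Lemma piZ c (x : A) : \pi_O (c *: x) = c *: \pi_O x.
Proof. exact: (pi_qscale idI). Qed.
Lemma pi1 : \pi_O (1 : A) = 1.
Proof. exact: lock. Qed.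
Lemma pi_eq (x y : A) : x - y \in ideal_gen (@qmat_relator F q m n) ->
  \pi_O x = \pi_O y.
Proof. by move=> Ix; apply/eqP; rewrite piE. Qed.
Lemma eq_pi (x y : A) : \pi_O x = \pi_O y ->
  x - y \in ideal_gen (@qmat_relator F q m n).
Proof. by move=> /eqP; rewrite piE. Qed.
End Presentation.

(** The four relations between the entries of the generic matrix, for the
    entries of an arbitrary matrix. *)
Definition quantum_matrix (F : fieldType) (p : F) (E : algType F) m n
    (z : 'I_m -> 'I_n -> E) : Prop :=
  [/\ forall i (j k : 'I_n), (j < k)%N -> z i j * z i k = p *: (z i k * z i j),
      forall (i k : 'I_m) j, (i < k)%N -> z i j * z k j = p *: (z k j * z i j),
      forall (i s : 'I_m) (j t : 'I_n), (s < i)%N -> (j < t)%N ->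
        z i j * z s t = z s t * z i j
    & forall (i s : 'I_m) (j t : 'I_n), (i < s)%N -> (j < t)%N ->
        z i j * z s t = z s t * z i j + (p - p^-1) *: (z i t * z s j)].

Section Lift.
Variables (F : fieldType) (q : F) (m n : nat) (E : algType F).
Variable z : 'I_m -> 'I_n -> E.
Local Notation A := (free_alg F ('I_m * 'I_n)%type).
Local Notation O := (Oq q m n).
Local Notation p := (q ^+ 2).
Local Notation relI := (ideal_gen (@qmat_relator F q m n)).

Definition word_eval (w : {fmonom ('I_m * 'I_n)%type}) : E :=
  \prod_(x <- (w : seq _)) z x.1 x.2.

Fact word_eval_morph : mmorphism word_eval.
Proof.
split=> [u v|]; first by rewrite /word_eval fmM big_cat.
by rewrite /word_eval fm1 big_nil.
Qed.
HB.instance Definition _ :=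
  isMultiplicative.Build _ _ word_eval word_eval_morph.

Definition free_eval : A -> E := mmap (in_alg E) word_eval.

Lemma free_eval_comm (g : A) (w w' : {fmonom ('I_m * 'I_n)%type}) :
  GRing.comm (in_alg E g@_w) (word_eval w').
Proof. by rewrite /GRing.comm /= mulr_algl mulr_algr. Qed.

Lemma free_evalM (x y : A) : free_eval (x * y) = free_eval x * free_eval y.
Proof. exact: (commr_mmap_is_multiplicative free_eval_comm).1. Qed.
Lemma free_eval1 : free_eval 1 = 1.
Proof. exact: (commr_mmap_is_multiplicative free_eval_comm).2. Qed.
Lemma free_evalB (x y : A) : free_eval (x - y) = free_eval x - free_eval y.
Proof. exact: mmapB. Qed.
Lemma free_evalD (x y : A) : free_eval (x + y) = free_eval x + free_eval y.
Proof. exact: mmapD. Qed.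
Lemma free_evalZ c (x : A) : free_eval (c *: x) = c *: free_eval x.
Proof. by rewrite /free_eval mmapZ /= mulr_algl. Qed.
Lemma free_eval_gen i j : free_eval (free_gen F (i, j)) = z i j.
Proof.
rewrite /free_eval unlock mmapU /= scale1r mul1r /word_eval fmU.
by rewrite big_seq1.
Qed.

Lemma free_eval_gen2 i j s t :
  free_eval (free_gen F (i, j) * free_gen F (s, t)) = z i j * z s t.
Proof. by rewrite free_evalM free_eval_gen free_eval_gen. Qed.

Hypothesis zP : quantum_matrix p z.

Lemma free_eval_relator x : @qmat_relator F q m n x -> free_eval x = 0.
Proof.
have [zr zc za zd] := zP.
have sub0 u v w : free_eval u = w -> free_eval v = w -> free_eval (u - v) = 0.
  by rewrite free_evalB => -> ->; rewrite subrr.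
case=> [i j k jk|i k j ik|i s j t si jt|i s j t si jt];
  apply: sub0 (free_eval_gen2 _ _ _ _) _.
- by rewrite free_evalZ [in LHS]free_eval_gen2 (zr _ _ _ jk).
- by rewrite free_evalZ [in LHS]free_eval_gen2 (zc _ _ _ ik).
- by rewrite [LHS]free_eval_gen2 (za _ _ _ _ si jt).
- rewrite [LHS]free_evalD free_evalZ (zd _ _ _ _ si jt).
  by congr (_ + _ *: _); apply: free_eval_gen2.
Qed.

Lemma free_eval_ker (x : A) : x \in relI -> free_eval x = 0.
Proof.
pose K : {pred A} := fun x => free_eval x == 0.
have inK y : free_eval y = 0 -> y \in K by move=> y0; apply/eqP.
have outK y : y \in K -> free_eval y = 0 by move/eqP.
move=> /asboolP/(_ K) h; apply/outK/h => [|y /free_eval_relator/inK//].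
split=> [|a y /outK y0|a y /outK y0].
- split=> [|u v /outK u0 /outK v0].
    by apply: inK; rewrite -(subrr 0) free_evalB subrr.
  by apply: inK; rewrite free_evalB u0 v0 subr0.
- by apply: inK; rewrite free_evalM y0 mulr0.
- by apply: inK; rewrite free_evalM y0 mul0r.
Qed.

Definition oq_eval (a : O) : E := free_eval (repr a).

Lemma oq_eval_pi (x : A) : oq_eval (\pi_O x) = free_eval x.
Proof.
apply/eqP; rewrite -subr_eq0 -free_evalB; apply/eqP/free_eval_ker/eq_pi.
by rewrite reprK.
Qed.

Fact oq_eval_linear : linear oq_eval.
Proof.
move=> c; elim/quotW=> x; elim/quotW=> y.
by rewrite -piZ -piD !oq_eval_pi free_evalD free_evalZ.
Qed.
Fact oq_eval_multiplicative : monoid_morphism oq_eval.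
Proof.
split=> [|x y]; first by rewrite -pi1 oq_eval_pi free_eval1.
elim/quotW: x => x; elim/quotW: y => y.
by rewrite -piM !oq_eval_pi free_evalM.
Qed.

(** The universal property: every quantum matrix over an algebra [E] is the
    image of the generic one under a morphism to [E]. *)
Lemma oq_lift : exists f : {lrmorphism O -> E}, forall i j, f (Z q i j) = z i j.
Proof.
pose f : {lrmorphism O -> E} := HB.pack oq_eval
  (GRing.isLinear.Build F O E _ oq_eval oq_eval_linear)
  (GRing.isMonoidMorphism.Build O E oq_eval oq_eval_multiplicative).
by exists f => i j; rewrite /= oq_eval_pi free_eval_gen.
Qed.
End Lift.

Section Generation.
Variables (F : fieldType) (q : F) (m n : nat).
Local Notation A := (free_alg F ('I_m * 'I_n)%type).
Local Notation O := (Oq q m n).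
Local Notation p := (q ^+ 2).

Lemma Z_qmx : quantum_matrix p (@Z F q m n).
Proof.
split=> [i j k jk|i k j ik|i s j t si jt|i s j t si jt];
  rewrite /Z -!piM -?piZ -?piD; apply: pi_eq; apply/asboolP => I _; apply.
- exact: RelRow.
- exact: RelCol.
- exact: RelAnti.
- exact: RelDiag.
Qed.

Lemma fmonom_prod (w : seq ('I_m * 'I_n)) :
  << fmonom_of_seq fmonom_key w >> = \prod_(x <- w) free_gen F x :> A.
Proof.
elim: w => [|x w IHw]; first by rewrite big_nil.
rewrite big_cons -IHw [in RHS]unlock [RHS](fgmulUU 1 1) mulr1.
by congr << _ *g _ >>; apply/eqP; rewrite -val_eqE /= fmM fmU !fmE.
Qed.

Lemma Oq_ind (S : {pred O}) : GRing.subalg_closed S ->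
  (forall i j, Z q i j \in S) -> forall a, a \in S.
Proof.
move=> hS SZ; have [S1 SL SM] := hS.
have S0 : 0 \in S by have := SL (-1) _ _ S1 S1; rewrite scaleN1r addNr.
elim/quotW=> x; rewrite (monalgE x).
elim/big_rec: _ => [|w y _ Sy]; [|set a := x@_w].
  by rewrite -(scale0r (1 : A)) piZ scale0r.
have -> : << a *g w >> = a *: << w >> :> A.
  by apply/malgP => k; rewrite [RHS]mcoeffZ [LHS]mcoeffU mcoeffU mulr_natr.
rewrite piD piZ; apply: SL => //.
have -> : w = fmonom_of_seq fmonom_key w.
  by apply/eqP; rewrite -val_eqE /= fmE.
rewrite fmonom_prod; elim: (w : seq _) => [|[i j] u IHu].
  by rewrite big_nil pi1.
by rewrite big_cons piM; apply: SM => //; apply: SZ.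
Qed.
End Generation.

(** * Products of quantum matrices *)

Lemma antisym_sum (V : zmodType) k (H : 'I_k -> 'I_k -> V) :
  (forall a, H a a = 0) -> (forall a b : 'I_k, (a < b)%N -> H a b + H b a = 0) ->
  \sum_a \sum_b H a b = 0.
Proof.
elim: k H => [|k IHk] H Hd Ho; first by rewrite big_ord0.
rewrite big_ord_recr /=.
under eq_bigr do rewrite big_ord_recr /=.
rewrite big_split /= IHk ?add0r => [|a|a b ab]; [|exact: Hd|exact: Ho].
rewrite [X in _ + X]big_ord_recr /= Hd addr0 -big_split big1 //= => a _.
apply: Ho => /=; exact: fintype.ltn_ord.
Qed.

Section Coproduct.
Variables (F : fieldType) (p : F) (E : algType F) (m k n : nat).
Variables (X : 'I_m -> 'I_k -> E) (Y : 'I_k -> 'I_n -> E).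
Hypotheses (p0 : p != 0) (XP : quantum_matrix p X) (YP : quantum_matrix p Y).
Hypothesis XY : forall i a b j, X i a * Y b j = Y b j * X i a.

Definition product_mx i j := \sum_a X i a * Y a j.

Lemma product_mxM i j s t :
  product_mx i j * product_mx s t = \sum_a \sum_b (X i a * X s b) * (Y a j * Y b t).
Proof.
rewrite mulr_suml; apply: eq_bigr => a _; rewrite mulr_sumr.
apply: eq_bigr => b _; rewrite -!mulrA; congr (_ * _).
by rewrite !mulrA -(XY s b a j).
Qed.

Let c := p - p^-1.
Let pc : p * c = p ^+ 2 - 1.
Proof. by rewrite /c mulrBr divff // expr2. Qed.
Let pcN : p * c - p * p = -1.
Proof. by rewrite pc -expr2 addrAC subrr sub0r. Qed.

(** The comultiplication of quantum matrices. In [product_mxM] the terms of index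
    [(a, b)] and [(b, a)] are brought into the same normal order by the relations
    of [X] and [Y]; the extra terms from the two diagonal relations cancel. *)
Lemma product_qmx : quantum_matrix p product_mx.
Proof.
have [xr xc xa xd] := XP; have [yr yc ya yd] := YP.
split=> [i j t jt|i s j ij|i s j t si jt|i s j t ij jt]; apply/eqP.
- rewrite -subr_eq0 !product_mxM scaler_sumr -sumrB; apply/eqP.
  under eq_bigr do rewrite scaler_sumr -sumrB.
  apply: antisym_sum => [a|a b ab]; first by rewrite yr // -scalerAr subrr.
  rewrite (xr i _ _ ab) (yd _ _ _ _ ab jt) (ya _ _ _ _ ab jt) -/c.
  move: (X i b * X i a) (Y b t * Y a j) (Y a t * Y b j) => W u v.
  rewrite mulrDr -!scalerAl -!scalerAr !scalerA -[_ + _ - _]addrA -scalerBl pcN.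
  by rewrite scaleN1r addrA subrK subrr.
- rewrite -subr_eq0 !product_mxM scaler_sumr -sumrB; apply/eqP.
  under eq_bigr do rewrite scaler_sumr -sumrB.
  apply: antisym_sum => [a|a b ab]; first by rewrite xc // -scalerAl subrr.
  rewrite (yc _ _ j ab) (xd _ _ _ _ ij ab) (xa _ _ _ _ ij ab) -/c.
  move: (Y b j * Y a j) (X s b * X i a) (X i b * X s a) => W u v.
  rewrite mulrDl -!scalerAl -!scalerAr !scalerA.
  rewrite -[_ + _ - _]addrA -scalerBl [c * p]mulrC pcN.
  by rewrite scaleN1r addrA subrK subrr.
- rewrite -subr_eq0 !product_mxM -sumrB; apply/eqP.
  under eq_bigr do rewrite -sumrB.
  apply: antisym_sum => [a|a b ab].
    by rewrite yr // [X s a * _]xc // -scalerAl -scalerAr subrr.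
  rewrite (xa _ _ _ _ si ab) (xd _ _ _ _ si ab) (yd _ _ _ _ ab jt).
  rewrite (ya _ _ _ _ ab jt) -/c.
  move: (X s b * X i a) (X i b * X s a) (Y b t * Y a j) (Y a t * Y b j) => g h u v.
  rewrite mulrDr mulrDl -!scalerAl -!scalerAr opprD addrA.
  by rewrite [- (h * v) - _]addrC addrA addrK subrK subrr.
rewrite -subr_eq0 !product_mxM opprD addrA scaler_sumr -!sumrB; apply/eqP.
under eq_bigr do rewrite scaler_sumr -!sumrB.
apply: antisym_sum => [a|a b ab].
  rewrite yr // xc // -!scalerAr -!scalerAl !scalerA -/c -expr2.
  by rewrite [c * p]mulrC pc scalerBl scale1r subrr.
rewrite (xd _ _ _ _ ij ab) (xa _ _ _ _ ij ab) (yd _ _ _ _ ab jt).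
rewrite (ya _ _ _ _ ab jt) -/c.
move: (X s b * X i a) (X i b * X s a) (Y b t * Y a j) (Y a t * Y b j) => u' v' u v.
rewrite mulrDr -scalerAr [_ - v' * v]addrAC addrK !addrA subrK mulrDl -scalerAl.
by rewrite [u' * u + _]addrC addrK subrr.
Qed.

End Coproduct.

(** * Elementary quantum matrices and oscillators *)

Section ElementaryMatrix.
Variables (F : fieldType) (p : F) (E : algType F).

(** The relations of [quantum_matrix] for the matrix with rows [x b] and [k d]. *)
Definition quantum_mx2 (x b k d : E) : Prop :=
  [/\ x * b = p *: (b * x) /\ k * d = p *: (d * k),
      x * k = p *: (k * x) /\ b * d = p *: (d * b), k * b = b * k
    & x * d = d * x + (p - p^-1) *: (b * k)].

(** The identity matrix, except for the block with rows [x b] and [k d] in rows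
    and columns [c] and [c.+1]. Indices are natural numbers, so that shifted
    windows of the matrix need no casts. *)
Definition elementary (x b k d : E) (c i j : nat) : E :=
  if i == c then (if j == c then x else if j == c.+1 then b else 0)
  else if i == c.+1 then (if j == c then k else if j == c.+1 then d else 0)
  else (i == j)%:R.

Variables (x b k d : E).
Hypothesis xbkd : quantum_mx2 x b k d.

Lemma elementary_shift c i j :
  elementary x b k d c (c + i) (c + j) = elementary x b k d 0 i j.
Proof.
have E0 a : (c + a == c)%N = (a == 0%N) by rewrite -[RHS](eqn_add2l c) addn0.
have E1 a : (c + a == c.+1)%N = (a == 1%N) by rewrite -[RHS](eqn_add2l c) addn1.
by rewrite /elementary !E0 !E1 eqn_add2l.
Qed.

Lemma elementary_comm (y : E) c i j : GRing.comm y x -> GRing.comm y b ->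
  GRing.comm y k -> GRing.comm y d -> GRing.comm y (elementary x b k d c i j).
Proof.
rewrite /elementary => yx yb yk yd; case: ifP => _;
  first by do 2?case: ifP => _ //; exact: commr0.
case: ifP => _; first by do 2?case: ifP => _ //; exact: commr0.
by case: (i == j); [exact: commr1 | exact: commr0].
Qed.

Lemma elementary_qmx c a a' m n :
  quantum_matrix p (fun (i : 'I_m) (j : 'I_n) =>
    elementary x b k d c (a + i) (a' + j)).
Proof.
case: xbkd => -[xb kd] [xk bd] kb xd; set G := elementary x b k d c.
have Gr (i j t : nat) : (j < t)%N -> G i j * G i t = p *: (G i t * G i j).
  rewrite /G /elementary => jt.
  by do ![case: eqP => ? /=]; subst; rewrite ?mul0r ?mulr0 ?scaler0 //; exfalso;
    lia.
have Gc (i s j : nat) : (i < s)%N -> G i j * G s j = p *: (G s j * G i j).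
  rewrite /G /elementary => ij.
  by do ![case: eqP => ? /=]; subst; rewrite ?mul0r ?mulr0 ?scaler0 //; exfalso;
    lia.
have Ga (i s j t : nat) : (s < i)%N -> (j < t)%N -> G i j * G s t = G s t * G i j.
  rewrite /G /elementary => si jt.
  by do ![case: eqP => ? /=]; subst; rewrite ?mul0r ?mulr0 ?mul1r ?mulr1 //;
    exfalso; lia.
have Gd (i s j t : nat) : (i < s)%N -> (j < t)%N ->
    G i j * G s t = G s t * G i j + (p - p^-1) *: (G i t * G s j).
  rewrite /G /elementary => ij jt.
  by do ![case: eqP => ? /=]; subst;
    rewrite ?mul0r ?mulr0 ?scaler0 ?addr0 ?mul1r ?mulr1 //; exfalso; lia.
split=> [i j t jt|i s j ij|i s j t si jt|i s j t ij jt].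
- by apply: Gr; rewrite ltn_add2l.
- by apply: Gc; rewrite ltn_add2l.
- by apply: Ga; rewrite ltn_add2l.
- by apply: Gd; rewrite ltn_add2l.
Qed.

End ElementaryMatrix.

Section Oscillators.
Variables (F : fieldType) (p : F) (T : eqType).
Hypothesis p0 : p != 0.

(** Basis vectors are indexed by exponents [e : T -> nat]; a vector is given by
    its coefficients. Infinite combinations are allowed, since the operators
    below are local and need no finiteness. *)
Definition fock : lmodType F := GRing.Lmodule.clone F ((T -> nat) -> F^o) _.

Lemma fock0E e : (0 : fock) e = 0. Proof. by []. Qed.
Lemma fockDE (f g : fock) e : (f + g) e = f e + g e. Proof. by []. Qed.
Lemma fockNE (f : fock) e : (- f) e = - f e. Proof. by []. Qed.
Lemma fockZE a (f : fock) e : (a *: f) e = a * f e. Proof. by []. Qed.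
Definition fockE := (fock0E, fockDE, fockNE, fockZE).

Definition vacuum : fock := fun e => `[< e = (fun _ : T => 0%N) >]%:R.

Lemma vacuum_neq0 : vacuum != 0.
Proof.
have v1 : vacuum (fun=> 0%N) = 1 by rewrite /vacuum asboolT.
apply/eqP => v0; move/eqP: v1; rewrite v0 fock0E eq_sym.
by rewrite (oner_eq0 F).
Qed.

Local Notation E := (endo vacuum_neq0).

Definition upd (e : T -> nat) s k : T -> nat := fun t => if t == s then k else e t.

Lemma upd_upd e s k k' : upd (upd e s k) s k' = upd e s k'.
Proof. by apply/funext => t; rewrite /upd; case: eqP. Qed.
Lemma upd_id e s : upd e s (e s) = e.
Proof. by apply/funext => t; rewrite /upd; case: eqP => // ->. Qed.
Lemma updC e s s' k k' : s != s' -> upd (upd e s k) s' k' = upd (upd e s' k') s k.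
Proof.
move=> ss'; apply/funext => t; rewrite /upd; case: eqP => // ->.
by rewrite eq_sym (negbTE ss').
Qed.
Lemma upd_same e s k : upd e s k s = k. Proof. by rewrite /upd eqxx. Qed.
Lemma upd_other e s k t : t != s -> upd e s k t = e t.
Proof. by rewrite /upd => /negbTE ->. Qed.

(** On the powers of one variable, [raise] multiplies by the variable, [scale]
    multiplies the [k]-th power by [p ^- k], and [lower] sends the [k]-th power
    to [lower_coef k] times the previous one. The value of [lower_coef] is forced
    by the diagonal relation and by [lower_coef 0 = 0]. *)
Definition lower_coef k : F := p * (p ^- (2 * k) - 1).

Definition raise_fun s (f : fock) : fock :=
  fun e => if e s is k.+1 then f (upd e s k) else 0.
Definition scale_fun s (f : fock) : fock := fun e => p ^- (e s) * f e.
Definition lower_fun s (f : fock) : fock :=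
  fun e => lower_coef (e s).+1 * f (upd e s (e s).+1).

Fact raise_lin s : linear (raise_fun s).
Proof.
move=> a f g; apply/funext => e; rewrite /raise_fun !fockE.
by case: (e s) => [|k]; rewrite ?mulr0 ?addr0 // !fockE.
Qed.
Fact scale_lin s : linear (scale_fun s).
Proof.
move=> a f g; apply/funext => e; rewrite /scale_fun !fockE.
by rewrite mulrDr mulrCA.
Qed.
Fact lower_lin s : linear (lower_fun s).
Proof.
move=> a f g; apply/funext => e; rewrite /lower_fun !fockE.
by rewrite mulrDr mulrCA.
Qed.
Definition raise s : E := Endo vacuum_neq0 (@raise_lin s).
Definition scale s : E := Endo vacuum_neq0 (@scale_lin s).
Definition lower s : E := Endo vacuum_neq0 (@lower_lin s).

Lemma raiseE s f e : raise s f e = if e s is k.+1 then f (upd e s k) else 0.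
Proof. by []. Qed.
Lemma scaleE s f e : scale s f e = p ^- (e s) * f e.
Proof. by []. Qed.
Lemma lowerE s f e : lower s f e = lower_coef (e s).+1 * f (upd e s (e s).+1).
Proof. by []. Qed.

Definition oscE := (endoE, raiseE, scaleE, lowerE, fockE, upd_same, upd_upd).

Lemma oscillator s : quantum_mx2 p (raise s) (scale s) (scale s) (lower s).
Proof.
have xk : raise s * scale s = p *: (scale s * raise s).
  apply: endoP => f; apply/funext => e.
  rewrite !oscE; case: (e s) => [|k]; rewrite ?oscE ?mulr0 //.
  by rewrite mulrA exprS invfM mulVKf.
have kd : scale s * lower s = p *: (lower s * scale s).
  apply: endoP => f; apply/funext => e.
  rewrite !oscE mulrCA [in RHS]mulrCA.
  by rewrite [in RHS](mulrA p) exprS invfM mulVKf // mulrCA.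
split=> //; apply: endoP => f; apply/funext => e.
  rewrite !oscE upd_id mulrA.
  have -> : (if e s is k.+1 then (lower s f) (upd e s k) else 0) =
      lower_coef (e s) * f e.
    case es: (e s) => [|k]; last by rewrite lowerE upd_same upd_upd -es upd_id.
    by rewrite /lower_coef muln0 expr0 invr1 subrr mulr0 mul0r.
  rewrite !mulrA -mulrDl; congr (_ * _); rewrite /lower_coef.
  rewrite mulnS exprD mul2n -addnn exprD;
    move: (p ^+ e s) (expf_neq0 (e s) p0) => u u0.
  by field; rewrite p0 u0.
Qed.

Lemma osc_comm s s' : s != s' ->
  forall (y : E), y \in [:: raise s; scale s; lower s] ->
  [/\ GRing.comm y (raise s'), GRing.comm y (scale s') & GRing.comm y (lower s')].
Proof.
move=> ss' y; have s's : s' != s by rewrite eq_sym.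
rewrite !inE => /or3P[] /eqP ->; split; apply: endoP => f; apply/funext => e;
  case es: (e s) => [|k]; case es': (e s') => [|k'];
  rewrite /= /raise_fun /lower_fun /scale_fun;
  do ![rewrite ?(upd_other _ _ ss') ?(upd_other _ _ s's) ?es ?es' /=];
  rewrite ?mulr0 ?(updC _ _ _ s's) //; exact: mulrCA.
Qed.

End Oscillators.

(** * The Fock module *)

Section Network.
Variables (F : fieldType) (p : F).
Hypothesis p0 : p != 0.
Variable N : nat.

Local Notation site := (nat * nat)%type.
Local Notation fock := (fock F site).
Local Notation E := (endo (@vacuum_neq0 F site)).

(** At the grid point [(s, t)] the line of row [s], which has already crossed
    [t] columns, crosses the line of column [t]; these are then the neighbouring
    lines of index [s + t] and [(s + t).+1]. *)
Definition vertex (x : site) (i j : nat) : E :=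
  elementary (raise F x) (scale p x) (scale p x) (lower p x) (x.1 + x.2) i j.

(** The entry [(i, j)] sums over the paths that enter the net of crossing lines
    at [i] and leave it at [j]. *)
Fixpoint network (l : seq site) : 'I_N -> 'I_N -> E :=
  if l is x :: l' then product_mx (fun i j : 'I_N => vertex x i j) (network l')
  else fun i j => (i == j)%:R.

Lemma vertex_comm x y i j s t : x != y -> GRing.comm (vertex x i j) (vertex y s t).
Proof.
move=> xy; have h := @osc_comm F p _ x y xy.
have hx (u : E) : u \in [:: raise F x; scale p x; lower p x] ->
    GRing.comm u (vertex y s t).
  by move=> /h[h1 h2 h3]; apply: elementary_comm.
by apply/commr_sym/elementary_comm; apply/commr_sym/hx; rewrite !inE eqxx ?orbT.
Qed.

Lemma network_comm x l i j s t : x \notin l ->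
  GRing.comm (vertex x i j) (network l s t).
Proof.
elim: l s t => [|y l IHl] s t /=.
  by move=> _; case: (s == t); [exact: commr1 | exact: commr0].
rewrite inE negb_or => /andP[xy xl]; rewrite /product_mx.
apply: commr_sum => a _; apply: commrM; last exact: IHl.
exact: vertex_comm.
Qed.

Lemma id_qmx (A : algType F) n :
  quantum_matrix p (fun i j : 'I_n => (i == j)%:R : A).
Proof.
split=> [i j t jt|i s j ij|i s j t si jt|i s j t ij jt];
  by do ![case: eqP => ? /=]; subst;
    rewrite ?mul0r ?mulr0 ?scaler0 ?addr0 ?mul1r ?mulr1 //; exfalso; lia.
Qed.

Lemma network_qmx l : uniq l -> quantum_matrix p (network l).
Proof.
elim: l => [|x l IHl] /=; first by move=> _; exact: id_qmx.
move=> /andP[xl ul]; apply: product_qmx => //; last 2 first.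
- exact: IHl.
- by move=> i a b j; apply: network_comm.
exact: (elementary_qmx (oscillator p0 x) _ 0 0).
Qed.

(** The effect of one vertex on a column of vectors, indexed by all of [nat]: a
    network is evaluated on a vector by folding this over its points. *)
Definition crossing (x : site) (w : nat -> fock) : nat -> fock := fun a =>
  let c := (x.1 + x.2)%N in
  if a == c then raise F x (w c) + scale p x (w c.+1)
  else if a == c.+1 then scale p x (w c) + lower p x (w c.+1)
  else w a.

Definition column (l : seq site) v (f : fock) : nat -> fock :=
  foldr crossing (fun a => if a == v then f else 0) l.

Lemma network_column l (i j : 'I_N) f :
  all (fun x : site => x.1 + x.2 < N.-1)%N l ->
  network l i j f = column l j f i.
Proof.
elim: l i => [|x l IHl] i /=.
  by move=> _; rewrite -val_eqE; case: eqP.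
move=> /andP[xN lN]; rewrite /product_mx endo_sumE.
under eq_bigr do rewrite endoE IHl //.
have cN : (x.1 + x.2 < N)%N by lia.
have c1N : ((x.1 + x.2).+1 < N)%N by lia.
pose c := Ordinal cN; pose c1 := Ordinal c1N.
have c1c : c1 != c by rewrite -val_eqE /=; lia.
rewrite /crossing /vertex /elementary; case: eqP => [ic|ic].
  rewrite (bigD1 c) //= (bigD1 c1) //= !eqxx eqn_leq ltnn /=.
  rewrite big1 ?addr0 // => a /andP[ac ac1].
  by rewrite -(val_eqE a c) -(val_eqE a c1) /= in ac ac1;
    rewrite (negbTE ac) (negbTE ac1) endoE.
case: eqP => [ic1|ic1].
  rewrite (bigD1 c) //= (bigD1 c1) //= !eqxx eqn_leq ltnn /=.
  rewrite big1 ?addr0 // => a /andP[ac ac1].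
  by rewrite -(val_eqE a c) -(val_eqE a c1) /= in ac ac1;
    rewrite (negbTE ac) (negbTE ac1) endoE.
rewrite (bigD1 i) //= eqxx endoE big1 ?addr0 // => a ai.
by rewrite eq_sym -val_eqE in ai; rewrite (negbTE ai) endoE.
Qed.
End Network.

Section FockModule.
Variables (F : fieldType).

Section Rows.
Variable p : F.
Local Notation site := (nat * nat)%type.
Local Notation fock := (fock F site).
Local Notation raise := (raise F).
Local Notation scale := (scale p).
Local Notation lower := (lower p).

Definition free_of (x : site) (f : fock) := forall e, e x != 0%N -> f e = 0.

Lemma free_of_scale x f : free_of x f -> scale x f = f.
Proof.
move=> xf; apply/funext => e; rewrite scaleE.
case: (eqVneq (e x) 0%N) => [->|/xf->]; last by rewrite mulr0.
by rewrite expr0 invr1 mul1r.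
Qed.

Lemma free_of_lower x f : free_of x f -> lower x f = 0.
Proof. by move=> xf; apply/funext => e; rewrite lowerE xf ?mulr0 // upd_same. Qed.

Lemma free_of_raise x y f : y != x -> free_of y f -> free_of y (raise x f).
Proof.
move=> yx yf e ey; rewrite raiseE; case: (e x) => // k.
by rewrite yf // upd_other.
Qed.

Definition row s t k : seq site := [seq (s, j) | j <- iota t k].

(** The last row comes first: the rows at the end of the product act first. *)
Fixpoint sites n k : seq site :=
  if k is k'.+1 then row k' 0 n ++ sites n k' else [::].

Lemma row_before s t k w a : (a < s)%N -> foldr (crossing p) w (row s t k) a = w a.
Proof.
move=> als; elim: k t => //= k IHk t; rewrite /crossing /= IHk.
by do 2?case: eqP => ? //; lia.
Qed.

(** A vector [f] on line [v + s], with no oscillator excited in columns before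
    [v] of row [s], either leaves on the line of row [s], with one more quantum
    at [(s, v)], or goes on. On the way back to line [s] the vertices before
    [v] see unexcited oscillators, where [lower] vanishes and [scale] is the
    identity. *)
Lemma row_pass s n v w f : (v < n)%N ->
  (forall a, (s <= a)%N -> w a = if a == (v + s)%N then f else 0) ->
  (forall t, (t < v)%N -> free_of (s, t) f) ->
  let w' := foldr (crossing p) w (row s 0 n) in
  w' s = raise (s, v) f /\
  (forall a, (s < a)%N -> w' a = if a == (v + s).+1 then scale (s, v) f else 0).
Proof.
move=> vn w_f f_free.
suff h k t : (t + k = n)%N -> let w' := foldr (crossing p) w (row s t k) in
    if (v < t)%N then forall a, (s <= a)%N -> w' a = if a == (v + s)%N then f else 0
    else w' (s + t)%N = raise (s, v) f /\
      forall a, (s <= a)%N -> a != (s + t)%N ->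
        w' a = if a == (v + s).+1 then scale (s, v) f else 0.
  have [h1 h2] := h n 0%N (add0n n); split; first by rewrite -[RHS]h1 addn0.
  by move=> a sa; apply: h2; lia.
elim: k t => [|k IHk] t tk /=.
  by rewrite (_ : (v < t)%N) //; lia.
have {IHk} := IHk t.+1; rewrite addSnnS => /(_ tk) /=.
set w' := foldr _ _ _ => h.
case: ltnP => [vt|tv].
  move: h; rewrite (ltn_trans vt) // => h a sa;
    rewrite /crossing [(_, _).1]/= [(_, _).2]/=.
  have -> : w' (s + t)%N = 0 by rewrite h ?leq_addr // ifF //; apply/eqP; lia.
  have -> : w' (s + t).+1 = 0 by rewrite h ?ifF //; [apply/eqP|]; lia.
  rewrite !endo0 addr0 (h _ sa).
  by case: eqP => [->|_]; [|case: eqP => [->|_ //]]; case: eqP => //; lia.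
case: (ltnP v t.+1) h => [vt1|vt1] h.
  have {vt1} {tv} tv : v = t by lia.
  subst t; rewrite /crossing [(_, _).1]/= [(_, _).2]/= eqxx.
  have -> : w' (s + v)%N = f by rewrite h ?leq_addr // addnC eqxx.
  have -> : w' (s + v).+1 = 0 by rewrite h ?ifF //; [apply/eqP|]; lia.
  rewrite [(v + s)%N]addnC; split; first by rewrite endo0 addr0.
  move=> a sa asv; rewrite (negbTE asv) endo0 addr0.
  by case: eqP => // _; rewrite h // [(v + s)%N]addnC (negbTE asv).
case: h => [h1 h2].
have tv' : (t < v)%N by lia.
have g_free : free_of (s, t) (raise (s, v) f).
  by apply: free_of_raise; [rewrite xpair_eqE eqxx /=; lia | exact: f_free].
rewrite /crossing [(_, _).1]/= [(_, _).2]/= eqxx -addnS h1.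
have -> : w' (s + t)%N = 0.
  by rewrite h2 ?leq_addr ?ifF //; [apply/eqP|]; lia.
rewrite !endo0 add0r free_of_scale // free_of_lower // addr0;
  split => // a sa /negbTE asv.
rewrite asv; case: eqP => [->|ast]; last by rewrite h2 //; apply/eqP.
by case: eqP => //; lia.
Qed.

Lemma sites_column n k u v f : (v < n)%N ->
  (forall s t, (s < u)%N || ((s == u) && (t < v)%N) -> free_of (s, t) f) ->
  (u < k)%N -> column p (sites n k) v f u = raise (u, v) f.
Proof.
move=> vn f_free.
have before j : (j <= u)%N -> forall a, (j <= a)%N ->
    column p (sites n j) v f a = if a == (v + j)%N then f else 0.
  elim: j => [|j IHj] ju a ja /=; first by rewrite addn0.
  rewrite /column foldr_cat; have f_j t : free_of (j, t) f by apply: f_free;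
    rewrite ju.
  have [||_ ->] := @row_pass j n v (column p (sites n j) v f) f vn _ _ => //.
    by apply: IHj; lia.
  by rewrite free_of_scale // addnS.
elim: k => // k IHk; rewrite ltnS leq_eqVlt => /orP[/eqP uk|uk] /=.
  rewrite -uk /column foldr_cat.
  have [|t tv|-> _] // := @row_pass u n v (column p (sites n u) v f) f vn.
    by apply: before.
  by apply: f_free; rewrite eqxx tv orbT.
by rewrite /column foldr_cat row_before //; apply: IHk.
Qed.

Lemma sites_uniq n k : uniq (sites n k).
Proof.
have rk s : uniq (row s 0 n) by rewrite map_inj_uniq ?iota_uniq // => i j [].
have sk j x : x \in sites n j -> (x.1 < j)%N.
  elim: j => // j IHj; rewrite mem_cat => /orP[/mapP[t _ ->] //|/IHj] /=; lia.
elim: k => //= k IHk; rewrite cat_uniq rk IHk /= andbT.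
by apply/hasPn => x /sk xk; apply/mapP => -[t _ xE]; move: xk; rewrite xE ltnn.
Qed.

Lemma sites_bound n k : (0 < n)%N ->
  all (fun x : site => x.1 + x.2 < (k + n).-1)%N (sites n k).
Proof.
move=> n0; elim: k => //= k IHk; rewrite all_cat; apply/andP; split.
  by apply/allP => x /mapP[t]; rewrite mem_iota => /andP[_ tn] -> /=; lia.
by apply: sub_all IHk => x /=; lia.
Qed.
End Rows.

(** The generators act as left multiplications in the basis of ordered
    monomials: on vectors that involve no variable before [(i, j)] in
    lexicographic order, [Z i j] multiplies by its own variable. *)
Lemma fock_module (q : F) m n : q != 0 ->
  exists f : {lrmorphism Oq q m n -> endo (@vacuum_neq0 F (nat * nat)%type)},
    forall (i : 'I_m) (j : 'I_n) (g : fock F (nat * nat)%type),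
    (forall s t : nat, (s < i)%N || ((s == i) && (t < j)%N) -> free_of (s, t) g) ->
    f (Z q i j) g = raise F (nat_of_ord i, nat_of_ord j) g.
Proof.
move=> q0; have p0 : q ^+ 2 != 0 by rewrite expf_neq0.
pose P := network (q ^+ 2) (sites n m) : 'I_(m + n) -> 'I_(m + n) -> _.
pose z (i : 'I_m) (j : 'I_n) :=
  P (widen_ord (leq_addr n m) i) (widen_ord (leq_addl m n) j).
have zP : quantum_matrix (q ^+ 2) z.
  have [hr hc ha hd] := network_qmx p0 (m + n) (sites_uniq n m).
  split=> *; [exact: hr|exact: hc|exact: ha|exact: hd].
have [f fZ] := oq_lift zP; exists f => i j g g_free.
have n0 : (0 < n)%N by apply: leq_ltn_trans (ltn_ord j).
by rewrite fZ /z /P network_column ?sites_bound //= sites_column.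
Qed.

End FockModule.

(** * Skew derivations *)

Section SkewDerivations.
Variables (F : fieldType) (q : F) (m n : nat).
Hypothesis q0 : q != 0.
Local Notation O := (Oq q m n).
Local Notation p := (q ^+ 2).
Local Notation Z := (Z q).

Let p0 : p != 0. Proof. exact: expf_neq0. Qed.

Definition skew_derivation (k e : O -> O) : Prop :=
  [/\ linear k, linear e, monoid_morphism k
    & forall a b, e (a * b) = e a * k b + a * e b].

(* A skew derivation is a representation by upper triangular 2 x 2 matrices with
   diagonal entries [a] and [k a] and upper right entry [e a]. *)
Local Notation W := (O * O)%type.
Fact w0_neq0 : ((0, 1) : W) != 0.
Proof. by rewrite xpair_eqE /= oner_eq0 andbF. Qed.
Local Notation E := (endo w0_neq0).

Fact lmul_lin (a : O) : linear (fun w : W => (a * w.1, a * w.2) : W).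
Proof. by move=> c [u u'] [v v']; congr (_, _); rewrite /= !mulrDr -!scalerAr. Qed.
Definition lmul a : E := Endo w0_neq0 (lmul_lin a).

Fact weight_lin (c : F) : linear (fun w : W => (w.1, c *: w.2) : W).
Proof.
by move=> a [u u'] [v v']; congr (_, _); rewrite /= scalerDr !scalerA mulrC.
Qed.
Definition weight c : E := Endo w0_neq0 (weight_lin c).

Fact shift_lin : linear (fun w : W => (w.2, 0) : W).
Proof. by move=> c [u u'] [v v']; congr (_, _); rewrite /= ?scaler0 ?addr0. Qed.
Definition shift : E := Endo w0_neq0 shift_lin.

Definition skewE := (endo_mulE, endo_addE, endo_scaleE, endo_zeroE, endo_oneE).

Lemma lmul_qmx : quantum_matrix p (fun i j => lmul (Z i j)).
Proof.
have [zr zc za zd] := Z_qmx q m n.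
have lM a b : lmul a * lmul b = lmul (a * b).
  by apply: endoP => w; rewrite !skewE /= !mulrA.
have lZ c a : c *: lmul a = lmul (c *: a).
  by apply: endoP => w; rewrite !skewE /= -!scalerAl.
have lD a b : lmul a + lmul b = lmul (a + b).
  by apply: endoP => w; rewrite !skewE /= !mulrDl.
split=> *; rewrite !lM ?lZ ?lD; congr lmul.
- exact: zr.
- exact: zc.
- exact: za.
- exact: zd.
Qed.

(** A quantum matrix over the triangular 2 x 2 matrices whose only entry away
    from the diagonal links the neighbours [c] and [c.+1]. Had there been an
    index between the two, its relations with that entry would fail. *)
Definition neighbour_mx (down : bool) c : nat -> nat -> E :=
  elementary (weight p^-1) (if down then 0 else shift) (if down then shift else 0)
    (weight p) c.

Lemma neighbour_qmx down c k :
  quantum_matrix p (fun i j : 'I_k => neighbour_mx down c i j).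
Proof.
apply: (elementary_qmx _ _ 0 0).
have ws a : weight a * shift = shift.
  by apply: endoP => w; rewrite !skewE /= scaler0.
have sw a : shift * weight a = a *: shift.
  by apply: endoP => w; rewrite !skewE /=; congr (_, _); rewrite /= scaler0.
have ww a b : weight a * weight b = weight (a * b).
  by apply: endoP => w; rewrite !skewE /= scalerA.
split; first by case: down; rewrite ?mul0r ?mulr0 ?scaler0 ?ws ?sw ?scalerA
  ?mulfV ?scale1r.
- by case: down; rewrite ?mul0r ?mulr0 ?scaler0 ?ws ?sw ?scalerA ?mulfV ?scale1r.
- by case: down; rewrite ?mul0r ?mulr0.
- by rewrite !ww mulrC; case: down; rewrite ?mul0r ?mulr0 scaler0 addr0.
Qed.

Lemma lmul_neighbour a down c i j :
  lmul a * neighbour_mx down c i j = neighbour_mx down c i j * lmul a.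
Proof.
have lw b : lmul a * weight b = weight b * lmul a.
  by apply: endoP => w; rewrite !skewE /= scalerAr.
have ls : lmul a * shift = shift * lmul a.
  by apply: endoP => w; rewrite !skewE /= mulr0.
apply: elementary_comm; [exact: lw| | |exact: lw]; case: down => //; exact: commr0.
Qed.

Definition neighbour_weight (c j : nat) : F :=
  if j == c then p^-1 else if j == c.+1 then p else 1.

Definition source (down : bool) (c : nat) := if down then c else c.+1.
Definition target (down : bool) (c : nat) := if down then c.+1 else c.

Lemma source_neg down c : source (~~ down) c = target down c.
Proof. by case: down. Qed.
Lemma target_neg down c : target (~~ down) c = source down c.
Proof. by case: down. Qed.

Lemma neighbour_mxE down c i j u v : neighbour_mx down c i j (u, v) =
  ((if i == j then u
    else if (i == source (~~ down) c) && (j == target (~~ down) c) then v else 0),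
   (if i == j then neighbour_weight c i *: v else 0)).
Proof.
rewrite /neighbour_mx /elementary /neighbour_weight /source /target.
case: down => /=; do ![case: eqP => ? /=]; subst; rewrite ?skewE //=;
  rewrite ?scale1r //; exfalso; lia.
Qed.

Lemma skew_of_lift (f : {lrmorphism O -> E}) (s : 'I_m -> 'I_n -> O)
  (t : 'I_m -> 'I_n -> F) :
  (forall i j w,
    f (Z i j) w = (Z i j * w.1 + s i j * w.2, t i j *: (Z i j * w.2))) ->
  exists k e, [/\ skew_derivation k e, forall i j, k (Z i j) = t i j *: Z i j
     & forall i j, e (Z i j) = s i j].
Proof.
move=> fZ; pose k a := (f a (0, 1)).2; pose e a := (f a (0, 1)).1.
have fE : forall a w, f a w = (a * w.1 + e a * w.2, k a * w.2).
  suff h (a : O) : a \in ((fun a => `[< exists x y, forall w,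
      f a w = (a * w.1 + x * w.2, y * w.2) >]) : {pred O}).
    move=> a w; have /asboolP[x [y fa]] := h a.
    by rewrite /k /e !fa /= mulr0 add0r !mulr1.
  apply: Oq_ind a; last first.
    move=> i j; apply/asboolP; exists (s i j), (t i j *: Z i j) => w.
    by rewrite fZ -scalerAl.
  split.
  - apply/asboolP; exists 0, 1 => w.
    by rewrite rmorph1 endo_oneE !mul1r mul0r addr0; case: w.
  - move=> c a b /asboolP[x [y fa]] /asboolP[x' [y' fb]]; apply/asboolP.
    exists (c *: x + x'), (c *: y + y') => w.
    rewrite linearP endo_addE endo_scaleE fa fb /=; congr (_, _).
      by rewrite /= !mulrDl scalerDr -!scalerAl addrACA.
    by rewrite /= !mulrDl -!scalerAl.
  - move=> a b /asboolP[x [y fa]] /asboolP[x' [y' fb]]; apply/asboolP.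
    exists (x * y' + a * x'), (y * y') => w.
    rewrite rmorphM endo_mulE fb fa /=; congr (_, _); rewrite /= ?mulrA //.
    by rewrite mulrDr !mulrA mulrDl addrAC addrA.
exists k, e; split; last 2 first.
- by move=> i j; rewrite /k fZ /= mulr1.
- by move=> i j; rewrite /e fZ /= mulr0 add0r mulr1.
split.
- by move=> c a b; rewrite /k linearP.
- by move=> c a b; rewrite /e linearP.
- split=> [|a b]; first by rewrite /k rmorph1.
  by rewrite {1}/k rmorphM endo_mulE !fE /= mulr1.
- by move=> a b; rewrite {1}/e rmorphM endo_mulE !fE /= mulr0 add0r !mulr1 addrC.
Qed.

(** Multiplying the generic matrix from the right by [neighbour_mx] adds one column
    to its neighbour; multiplication from the left does the same for rows. *)
Lemma col_skew down c (s t : 'I_n) :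
  s = source down c :> nat -> t = target down c :> nat -> exists k e,
  [/\ skew_derivation k e, forall i j, k (Z i j) = neighbour_weight c j *: Z i j
    & forall i j, e (Z i j) = if j == s then Z i t else 0].
Proof.
move=> sE tE.
have ts : t != s.
  by rewrite -val_eqE /= sE tE; case: (down) => /=; apply/eqP; lia.
have [|f fZ] := oq_lift (product_qmx p0 lmul_qmx (@neighbour_qmx down c n) _).
  by move=> i a b j; apply: lmul_neighbour.
apply: (@skew_of_lift f _ (fun _ j => neighbour_weight c j)) => i j [u v].
rewrite fZ endo_sumE.
under eq_bigr do rewrite endo_mulE neighbour_mxE source_neg target_neg -sE -tE
  !val_eqE.
rewrite (bigD1 j) //= eqxx; case: (eqVneq j s) => [->|js] /=.
  rewrite (bigD1 t) //= (negbTE ts) !eqxx big1 => [|a /andP[/negbTE-> /negbTE->]].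
    by rewrite addr0; congr (_, _); rewrite /= ?mulr0 ?addr0 // scalerAr.
  by congr (_, _); rewrite /= mulr0.
rewrite big1 => [|a /negbTE->].
  by rewrite addr0 mul0r addr0 scalerAr.
by rewrite andbF; congr (_, _); rewrite /= mulr0.
Qed.

Lemma row_skew down c (s t : 'I_m) :
  s = source down c :> nat -> t = target down c :> nat -> exists k e,
  [/\ skew_derivation k e, forall i j, k (Z i j) = neighbour_weight c i *: Z i j
    & forall i j, e (Z i j) = if i == s then Z t j else 0].
Proof.
move=> sE tE.
have ts : t != s.
  by rewrite -val_eqE /= sE tE; case: (down) => /=; apply/eqP; lia.
have [|f fZ] := oq_lift (product_qmx p0 (@neighbour_qmx (~~ down) c m) lmul_qmx _).
  by move=> i a b j; rewrite lmul_neighbour.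
apply: (@skew_of_lift f _ (fun i _ => neighbour_weight c i)) => i j [u v].
rewrite fZ endo_sumE.
under eq_bigr do rewrite endo_mulE neighbour_mxE negbK -sE -tE !val_eqE.
rewrite (bigD1 i) //= eqxx; case: (eqVneq i s) => [->|js] /=.
  rewrite (bigD1 t) //= eq_sym (negbTE ts) !eqxx.
  rewrite big1 => [|a /andP[/negbTE as_ /negbTE ->]]; last by rewrite eq_sym as_.
  by rewrite addr0; congr (_, _); rewrite /= ?mulr0 ?addr0.
rewrite big1 => [|a]; first by rewrite addr0 mul0r addr0.
by rewrite eq_sym => /negbTE->.
Qed.
End SkewDerivations.

(** * Inversions of a permutation *)

Section Inversions.
Variable r : nat.
Implicit Types (s : 'S_r) (c d : 'I_r).

Lemma perm_length_swap s c d : d = c.+1 :> nat -> ((s^-1)%g c < (s^-1)%g d)%N ->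
  perm_length (s * tperm c d)%g = (perm_length s).+1.
Proof.
move=> dc; set x0 := (s^-1)%g c; set y0 := (s^-1)%g d => xy0.
have sx0 : s x0 = c by rewrite /x0 permKV.
have sy0 : s y0 = d by rewrite /y0 permKV.
rewrite /perm_length.
set A := [set p | _]; set B := [set p | _].
have -> : A = (x0, y0) |: B.
  apply/setP => -[x y]; rewrite !inE /= xpair_eqE !permM.
  rewrite -(inj_eq (@perm_inj _ s) x) -(inj_eq (@perm_inj _ s) y) sx0 sy0.
  have xy_c : s x = c -> s y = d -> (x < y)%N.
    by move=> xc yd; rewrite -(permK s x) -(permK s y) xc yd.
  have xy_d : s x = d -> s y = c -> (x < y)%N = false.
    move=> xd yc; rewrite -(permK s x) -(permK s y) xd yc.
    by apply/negbTE; rewrite -leqNgt ltnW.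
  have sxy : s x = s y -> x = y by apply: perm_inj.
  have vE u v : (u == v :> 'I_r) = (u == v :> nat) by [].
  have xy_v : s x = s y :> nat -> x = y :> nat by move=> /val_inj /sxy ->.
  have xy_cv : s x = c :> nat -> s y = d :> nat -> (x < y)%N.
    by move=> /val_inj + /val_inj; apply: xy_c.
  have xy_dv : s x = d :> nat -> s y = c :> nat -> (x < y)%N = false.
    by move=> /val_inj + /val_inj; apply: xy_d.
  rewrite !vE; move: xy_v xy_cv xy_dv; clear xy_c xy_d sxy.
  case: tpermP => [->|->|/eqP + /eqP +]; case: tpermP => [->|->|/eqP + /eqP +];
    rewrite ?vE; lia.
rewrite cardsU1 (_ : (x0, y0) \notin B) ?add1n //.
by rewrite inE /= sx0 sy0; lia.
Qed.

Lemma perm_lengthV s : perm_length (s^-1)%g = perm_length s.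
Proof.
pose g (x : 'I_r * 'I_r) := ((s^-1)%g x.2, (s^-1)%g x.1).
have g_inj : injective g by move=> [a b] [a' b'] [/perm_inj -> /perm_inj ->].
rewrite /perm_length -[in RHS](card_preimset _ g_inj); apply: eq_card => -[a b].
by rewrite !inE /= !permKV andbC.
Qed.

Lemma perm_length_swapl s c d : d = c.+1 :> nat -> (s c < s d)%N ->
  perm_length (tperm c d * s)%g = (perm_length s).+1.
Proof.
move=> dc cd; rewrite -perm_lengthV invMg tpermV perm_length_swap ?invgK //.
by rewrite perm_lengthV.
Qed.
End Inversions.

(** Pairing each term with its partner, rather than comparing the sum with its
    opposite, keeps this valid in characteristic 2. *)
Lemma sum_involution (V : zmodType) (T : finType) (phi : T -> T) (P : pred T)
    (h : T -> V) : involutive phi -> (forall t, P (phi t) = ~~ P t) ->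
  (forall t, P t -> h t + h (phi t) = 0) -> \sum_t h t = 0.
Proof.
move=> phiK Pphi h0; rewrite (bigID P) /=
  [X in _ + X](reindex_inj (inv_inj phiK)) /=.
under [X in _ + X]eq_bigl do rewrite Pphi negbK.
by rewrite -big_split big1.
Qed.

Lemma prod_swap (F : fieldType) (A : algType F) (a : F) r (f g : 'I_r -> A) c :
  (forall i : 'I_r, i != c :> nat -> i != c.+1 :> nat -> f i = g i) ->
  (forall i j : 'I_r, i = c :> nat -> j = c.+1 :> nat ->
     f i * f j = a *: (g i * g j)) ->
  (c.+1 < r)%N -> \prod_i f i = a *: \prod_i g i.
Proof.
elim: r f g c => // r IHr f g [|c] fg fg2 cr.
  case: r cr IHr f g fg fg2 => // r _ _ f g fg fg2.
  rewrite !big_ord_recl !mulrA fg2 // -!scalerAl; congr (_ *: (_ * _)).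
  by apply: eq_bigr => i _; apply: fg.
rewrite !big_ord_recl fg // (IHr _ (fun i => g (lift ord0 i)) c) ?scalerAr //.
- by move=> i ic ic1; apply: fg; rewrite lift0 eqSS.
- by move=> i j ic jc; apply: fg2; rewrite lift0 ?ic ?jc.
Qed.

(** * Skew derivations kill quantum minors *)

Lemma prod_eq0 (R : pzRingType) r (z : 'I_r -> R) i : z i = 0 -> \prod_j z j = 0.
Proof.
elim: r z i => [|r IHr] z i zi; first by case: i zi.
rewrite big_ord_recl; case: (unliftP ord0 i) zi => [j ->|->] zi;
  last by rewrite zi mul0r.
by rewrite (IHr (fun j => z (lift ord0 j)) j) ?mulr0.
Qed.

Section MinorKilled.
Variables (F : fieldType) (q : F) (m n : nat).
Hypothesis q0 : q != 0.
Local Notation O := (Oq q m n).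
Local Notation p := (q ^+ 2).
Local Notation Z := (Z q).

Let p0 : p != 0. Proof. exact: expf_neq0. Qed.

Section Skew.
Variables (k e : O -> O).
Hypothesis ke : skew_derivation k e.

Lemma skew_kprod r (z : 'I_r -> O) : k (\prod_i z i) = \prod_i k (z i).
Proof.
case: ke => _ _ [k1 kM] _; exact: (big_morph k kM k1).
Qed.

Lemma skew_e1 : e 1 = 0.
Proof.
case: ke => _ _ [k1 _] eM; have := eM 1 1.
by rewrite k1 !mulr1 mul1r => /(congr1 (fun x => x - e 1)); rewrite subrr addrK.
Qed.

Lemma skew_eprod r (z : 'I_r -> O) : e (\prod_i z i) =
  \sum_(l < r) \prod_(i < r)
    (if (i < l)%N then z i else if i == l then e (z i) else k (z i)).
Proof.
case: (ke) => _ _ _ eM; elim: r z => [|r IHr] z; first by rewrite !big_ord0 skew_e1.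
rewrite big_ord_recl eM IHr skew_kprod mulr_sumr big_ord_recl big_ord_recl.
congr (_ + _); apply: eq_bigr => l _; rewrite big_ord_recl.
by congr (_ * _); apply: eq_bigr => i _.
Qed.

Lemma skew_e_linear I (r : seq I) P (c : I -> F) (a : I -> O) :
  e (\sum_(i <- r | P i) c i *: a i) = \sum_(i <- r | P i) c i *: e (a i).
Proof.
case: ke => _ el _ _; have e0 : e 0 = 0.
  by have := el (-1) 0 0; rewrite scaler0 addr0 scaleN1r addNr.
by elim/big_rec2: _ => // i u v _ <-; rewrite el.
Qed.

Lemma skew_k_linear I (r : seq I) P (c : I -> F) (a : I -> O) :
  k (\sum_(i <- r | P i) c i *: a i) = \sum_(i <- r | P i) c i *: k (a i).
Proof.
case: ke => kl _ _ _; have k0 : k 0 = 0.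
  by have := kl (-1) 0 0; rewrite scaler0 addr0 scaleN1r addNr.
by elim/big_rec2: _ => // i u v _ <-; rewrite kl.
Qed.

(** A skew derivation that kills [M] turns one [q]-commutation rule into the
    next. *)
Lemma skew_transfer (M a : O) c : k M = M -> e M = 0 ->
  M * a = c *: (a * M) -> M * e a = c *: (e a * M).
Proof.
case: (ke) => _ el _ eM kM M0 /(congr1 e); rewrite eM M0 mul0r add0r => ->.
have eZ x : e (c *: x) = c *: e x.
  by have := @skew_e_linear _ [:: tt] predT (fun _ => c) (fun _ => x);
    rewrite !big_seq1.
by rewrite eZ eM kM M0 mulr0 addr0.
Qed.
End Skew.

Section Killed.
Variables (r : nat) (I : 'I_r -> 'I_m) (J : 'I_r -> 'I_n).

(** The derivation puts column [J d] in the place of [J c] (or the other way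
    round). The terms of a permutation and of its product with the transposition
    of [c] and [d] then involve the same monomial; their lengths differ by one,
    and the weight picked up by the entry to the right of the new one supplies
    the missing factor [p]. *)
Lemma col_killed down (c d : 'I_r) : d = c.+1 :> nat ->
  J d = (J c).+1 :> nat -> injective J ->
  exists k e, [/\ skew_derivation k e, k (qminor q I J) = qminor q I J,
    e (qminor q I J) = 0 & forall i,
    e (Z i (J (if down then c else d))) = Z i (J (if down then d else c))].
Proof.
move=> dc Jdc J_inj; set s := if down then c else d; set t := if down then d else c.
have [||k [e [ke kZ eZ]]] := @col_skew _ _ m n q0 down (J c) (J s) (J t).
- by rewrite /s /source; case: (down).
- by rewrite /t /target; case: (down).
exists k, e; split=> //; last by move=> i; rewrite eZ eqxx.
- rewrite (skew_k_linear ke); apply: eq_bigr => sg _; congr (_ *: _).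
  rewrite (skew_kprod ke); under eq_bigr do rewrite kZ.
  rewrite scaler_prod (reindex_inj (@perm_inj _ sg^-1)%g) /=.
  under eq_bigr do rewrite permKV.
  rewrite (bigD1 c) //= (bigD1 d) /=; last by rewrite -val_eqE /= dc; lia.
  rewrite /neighbour_weight eqxx -Jdc eqxx big1 ?mulr1 => [|i /andP[ic id_]].
    by rewrite ifF ?mulVf ?scale1r //; apply/eqP; lia.
  by rewrite !val_eqE !(inj_eq J_inj) (negbTE ic) (negbTE id_).
pose J' (i : 'I_r) := if i == s then J t else J i.
pose w (sg : 'S_r) := \prod_i Z (I i) (J' (sg i)).
pose al (sg : 'S_r) := if ((sg^-1)%g s < (sg^-1)%g t)%N then
  neighbour_weight q (J c) (J t) else 1.
have cd : c != d by rewrite -val_eqE /= dc; lia.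
have st : t != s by rewrite /s /t; case: (down) => //; rewrite eq_sym.
have e_mono (sg : 'S_r) : e (\prod_i Z (I i) (J (sg i))) = al sg *: w sg.
  set l := (sg^-1)%g s.
  have slE i : (J (sg i) == J s) = (i == l).
    by rewrite (inj_eq J_inj) -(inj_eq (@perm_inj _ sg)) permKV.
  rewrite (skew_eprod ke) (bigD1 l) //= [X in _ + X]big1 ?addr0 => [|l' ll'];
    last first.
    by apply: (@prod_eq0 _ _ _ l'); rewrite ltnn eqxx eZ slE (negbTE ll').
  pose ga (i : 'I_r) := if (i <= l)%N then 1 else
    neighbour_weight q (J c) (J (sg i)).
  have -> : al sg = \prod_i ga i.
    rewrite (bigD1 ((sg^-1)%g t)) //= {1}/ga permKV leqNgt /al -/l if_neg.
    rewrite big1 ?mulr1 // => i it; rewrite /ga.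
    case: leqP => // li; have sgs : sg i != s.
      by rewrite -(permKV sg s) (inj_eq perm_inj) neq_ltn li orbT.
    have sgt : sg i != t by rewrite -(permKV sg t) (inj_eq perm_inj).
    have [sgc sgd] : sg i != c /\ sg i != d.
      by move: sgs sgt; rewrite /s /t; case: (down).
    by rewrite /neighbour_weight -Jdc !val_eqE !(inj_eq J_inj) (negbTE sgc)
      (negbTE sgd).
  rewrite -scaler_prod; apply: eq_bigr => i _; rewrite /ga /J'.
  rewrite -(inj_eq J_inj (sg i) s) slE; case: ltngtP => [il|il|/val_inj ->].
  - by rewrite (negbTE (_ : i != l)) ?scale1r // neq_ltn il.
  - by rewrite (negbTE (_ : i != l)) ?kZ // neq_ltn il orbT.
  - by rewrite eqxx eZ slE eqxx scale1r.
rewrite (skew_e_linear ke); under eq_bigr do rewrite e_mono.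
apply: (@sum_involution _ _ (fun sg => sg * tperm c d)%g
  (fun sg : 'S_r => ((sg^-1)%g c < (sg^-1)%g d)%N)).
- by move=> sg; rewrite -mulgA tperm2 mulg1.
- move=> sg; rewrite invMg tpermV !permM tpermL tpermR -leqNgt [RHS]leq_eqVlt.
  by rewrite (inj_eq (@ord_inj r)) (inj_eq perm_inj) eq_sym (negbTE cd).
move=> sg sgcd; rewrite perm_length_swap //.
have -> : w (sg * tperm c d)%g = w sg.
  apply: eq_bigr => i _; rewrite permM; congr Z; rewrite /J' /s /t.
  by case: tpermP => [->|->|//]; case: (down);
    rewrite !eqxx ?[d == c]eq_sym ?(negbTE cd).
rewrite !scalerA -scalerDl; apply/eqP; rewrite scaler_eq0; apply/orP; left.
rewrite [(- p) ^+ _.+1]exprS [- p * _]mulrC -mulrA -mulrDr mulf_eq0 mulNr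
  subr_eq0; apply/orP; right.
have dcE : (J d == (J c) :> nat) = false by rewrite Jdc; apply/eqP; lia.
rewrite /al invMg tpermV !permM /s /t /neighbour_weight; case: (down);
  rewrite ?tpermL ?tpermR sgcd ltnNge (ltnW sgcd) /= ?dcE ?Jdc ?eqxx ?mulr1 //.
by rewrite mulfV.
Qed.

(** Here the missing factor [p] comes from exchanging the two neighbouring
    entries that have been moved into the same row. *)
Lemma row_killed down (c d : 'I_r) : d = c.+1 :> nat ->
  I d = (I c).+1 :> nat -> injective I ->
  (forall i j : 'I_r, (i < j)%N -> (J i < J j)%N) ->
  exists k e, [/\ skew_derivation k e, k (qminor q I J) = qminor q I J,
    e (qminor q I J) = 0 & forall j,
    e (Z (I (if down then c else d)) j) = Z (I (if down then d else c)) j].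
Proof.
move=> dc Idc I_inj J_inc; set s := if down then c else d;
  set t := if down then d else c.
have [||k [e [ke kZ eZ]]] := @row_skew _ _ m n q0 down (I c) (I s) (I t).
- by rewrite /s /source; case: (down).
- by rewrite /t /target; case: (down).
have cd : c != d by rewrite -val_eqE /= dc; lia.
have st : t != s by rewrite /s /t; case: (down) => //; rewrite eq_sym.
have dcE : (I d == (I c) :> nat) = false by rewrite Idc; apply/eqP; lia.
exists k, e; split=> //; last by move=> j; rewrite eZ eqxx.
- rewrite (skew_k_linear ke); apply: eq_bigr => sg _; congr (_ *: _).
  rewrite (skew_kprod ke); under eq_bigr do rewrite kZ.
  rewrite scaler_prod (bigD1 c) //= (bigD1 d) /=; last by rewrite eq_sym.
  rewrite /neighbour_weight eqxx -Idc eqxx big1 ?mulr1 => [|i /andP[ic id_]].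
    by rewrite dcE ?mulVf ?scale1r.
  by rewrite !val_eqE !(inj_eq I_inj) (negbTE ic) (negbTE id_).
pose I' (i : 'I_r) := if i == s then I t else I i.
pose w (sg : 'S_r) := \prod_i Z (I' i) (J (sg i)).
pose al := if (s < t)%N then neighbour_weight q (I c) (I t) else 1.
have e_mono (sg : 'S_r) : e (\prod_i Z (I i) (J (sg i))) = al *: w sg.
  rewrite (skew_eprod ke) (bigD1 s) //= [X in _ + X]big1 ?addr0 => [|l' ll'];
    last first.
    by apply: (@prod_eq0 _ _ _ l'); rewrite ltnn eqxx eZ (inj_eq I_inj)
      (negbTE ll').
  pose ga (i : 'I_r) := if (i <= s)%N then 1 else neighbour_weight q (I c) (I i).
  have -> : al = \prod_i ga i.
    rewrite (bigD1 t) //= {1}/ga leqNgt /al if_neg.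
    rewrite big1 ?mulr1 // => i it; rewrite /ga.
    case: leqP => // li; have is_ : i != s by rewrite neq_ltn li orbT.
    have [ic id_] : i != c /\ i != d.
      by move: is_ it; rewrite /s /t; case: (down).
    by rewrite /neighbour_weight -Idc !val_eqE !(inj_eq I_inj) (negbTE ic)
      (negbTE id_).
  rewrite -scaler_prod; apply: eq_bigr => i _; rewrite /ga /I'.
  case: ltngtP => [il|il|/val_inj ->].
  - by rewrite (negbTE (_ : i != s)) ?scale1r // neq_ltn il.
  - by rewrite (negbTE (_ : i != s)) ?kZ // neq_ltn il orbT.
  - by rewrite eqxx eZ eqxx scale1r.
rewrite (skew_e_linear ke); under eq_bigr do rewrite e_mono scalerA mulrC -scalerA.
rewrite -scaler_sumr (_ : \sum_(sg : 'S_r) _ = 0) ?scaler0 //.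
apply: (@sum_involution _ _ (fun sg => tperm c d * sg)%g
  (fun sg : 'S_r => (sg c < sg d)%N)).
- by move=> sg; rewrite mulgA tperm2 mul1g.
- move=> sg; rewrite !permM tpermL tpermR -leqNgt [RHS]leq_eqVlt.
  by rewrite (inj_eq (@ord_inj r)) (inj_eq perm_inj) eq_sym (negbTE cd).
move=> sg sgcd; rewrite perm_length_swapl //.
have I'E i : (i == c) || (i == d) -> I' i = I t.
  by move/orP=> [] /eqP ->; rewrite /I' /s /t; case: (down); rewrite ?eqxx //;
    case: eqP.
have -> : w sg = p *: w (tperm c d * sg)%g.
  apply: (@prod_swap _ _ _ _ _ _ c) => [i ic id_|i j /val_inj -> jc|].
  - by rewrite permM tpermD // -val_eqE /= eq_sym ?dc.
  - have -> : j = d by apply/val_inj; rewrite /= jc dc.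
    rewrite !I'E ?eqxx ?orbT // !permM tpermL tpermR.
    by have [zr _ _ _] := Z_qmx q m n; apply/zr/J_inc.
  - by rewrite -dc.
by rewrite [(- p) ^+ _.+1]exprS scalerA -scalerDl [- p * _]mulrC mulrN subrr
  scale0r.
Qed.

End Killed.
End MinorKilled.

(** * Solid minors commute with the generators up to a scalar *)

Section MinorNormal.
Variables (F : fieldType) (q : F) (m n : nat).
Hypothesis q0 : q != 0.
Local Notation O := (Oq q m n).
Local Notation p := (q ^+ 2).
Local Notation Z := (Z q).

Let p0 : p != 0. Proof. exact: expf_neq0. Qed.

Definition q_commute (c : F) (M a : O) : Prop := M * a = c *: (a * M).

Lemma prod_q_commute (A : algType F) r (z : 'I_r -> A) (c : 'I_r -> F) a :
  (forall i, z i * a = c i *: (a * z i)) ->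
  (\prod_i z i) * a = (\prod_i c i) *: (a * \prod_i z i).
Proof.
elim: r z c => [|r IHr] z c za; first by rewrite !big_ord0 scale1r mul1r mulr1.
rewrite !big_ord_recl -mulrA (IHr _ (fun i => c (lift ord0 i))) // -scalerAr.
by rewrite [_ * (a * _)]mulrA za -!scalerAl scalerA [_ * c _]mulrC mulrA.
Qed.

(** If the factor depends on the row times the column, all monomials of the
    minor give the same one, as each row and column occurs once. *)
Lemma minor_weight r (I : 'I_r -> 'I_m) (J : 'I_r -> 'I_n) a (mu nu : 'I_r -> F) :
  (forall i j, Z (I i) (J j) * a = (mu i * nu j) *: (a * Z (I i) (J j))) ->
  q_commute ((\prod_i mu i) * \prod_j nu j) (qminor q I J) a.
Proof.
move=> Za; rewrite /q_commute mulr_suml mulr_sumr scaler_sumr;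
  apply: eq_bigr => s _.
rewrite -scalerAl -scalerAr [RHS]scalerA [_ * _ ^+ _]mulrC -scalerA; congr (_ *: _).
have -> : \prod_j nu j = \prod_i nu (s i) by apply: reindex_inj; exact: perm_inj.
by rewrite -big_split; apply: prod_q_commute => i; apply: Za.
Qed.

Lemma consecutiveE r d (f : 'I_r.+1 -> 'I_d) k : consecutive f ->
  f k = (f ord0 + k)%N :> nat.
Proof.
move=> fP; case: k; elim=> [|k IHk] kr; first by rewrite addn0;
  congr (nat_of_ord (f _)); apply: val_inj.
by rewrite (fP (Ordinal (ltnW kr)) (Ordinal kr)) // IHk /= addnS.
Qed.

Section Box.
Variables (r : nat) (I : 'I_r.+1 -> 'I_m) (J : 'I_r.+1 -> 'I_n).
Hypotheses (Icons : consecutive I) (Jcons : consecutive J).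
Local Notation M := (qminor q I J).

Let IE k : I k = (I ord0 + k)%N :> nat. Proof. exact: consecutiveE. Qed.
Let JE k : J k = (J ord0 + k)%N :> nat. Proof. exact: consecutiveE. Qed.
Let I_inj : injective I.
Proof.
by move=> i j /(congr1 val) /=; rewrite (IE i) (IE j) => /addnI /val_inj.
Qed.
Let J_inj : injective J.
Proof.
by move=> i j /(congr1 val) /=; rewrite (JE i) (JE j) => /addnI /val_inj.
Qed.
Let J_inc (i j : 'I_r.+1) : (i < j)%N -> (J i < J j)%N.
Proof. by rewrite (JE i) (JE j) ltn_add2l. Qed.

(** Only the entries in the row and in the column of the point contribute. *)
Definition ne_factor (s : 'I_m) (t : 'I_n) : F :=
  (\prod_i if I i == s then p else 1) * \prod_j if J j == t then p^-1 else 1.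
Definition sw_factor (s : 'I_m) (t : 'I_n) : F :=
  (\prod_i if I i == s then p^-1 else 1) * \prod_j if J j == t then p else 1.

Lemma north_east_commute (s : 'I_m) (t : 'I_n) : (s <= I ord0)%N ->
  (J ord_max <= t)%N ->
  q_commute (ne_factor s t) M (Z s t).
Proof.
have [zr zc za _] := Z_qmx q m n; move=> sI tJ; apply: minor_weight => i j.
have jtE : (J j <= t)%N.
  by rewrite (leq_trans _ tJ) // (JE j) (JE ord_max) leq_add2l /= -ltnS ltn_ord.
have : (s <= I i)%N by rewrite (IE i) (leq_trans sI) ?leq_addr.
move: jtE; rewrite leq_eqVlt => /orP[/eqP/val_inj <-|jt];
  rewrite leq_eqVlt => /orP[/eqP/val_inj <-|si].
- by rewrite !eqxx mulfV // scale1r.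
- rewrite eqxx (@ifF _ (I i == s)); last by apply: gtn_eqF.
  by rewrite mul1r (zc _ _ _ si) scalerA mulVf // scale1r.
- rewrite eqxx (@ifF _ (J j == t)); last by apply: ltn_eqF.
  by rewrite mulr1 (zr _ _ _ jt).
- rewrite (@ifF _ (J j == t)); last by apply: ltn_eqF.
  rewrite (@ifF _ (I i == s)); last by apply: gtn_eqF.
  by rewrite mulr1 scale1r (za _ _ _ _ si jt).
Qed.

Lemma south_west_commute (s : 'I_m) (t : 'I_n) : (I ord_max <= s)%N ->
  (t <= J ord0)%N ->
  q_commute (sw_factor s t) M (Z s t).
Proof.
have [zr zc za _] := Z_qmx q m n; move=> sI tJ; apply: minor_weight => i j.
have isE : (I i <= s)%N.
  by rewrite (leq_trans _ sI) // (IE i) (IE ord_max) leq_add2l /= -ltnS ltn_ord.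
have : (t <= J j)%N by rewrite (JE j) (leq_trans tJ) ?leq_addr.
move: isE; rewrite leq_eqVlt => /orP[/eqP/val_inj <-|si];
  rewrite leq_eqVlt => /orP[/eqP/val_inj <-|tj].
- by rewrite !eqxx mulVf // scale1r.
- rewrite eqxx (@ifF _ (J j == t)); last by apply: gtn_eqF.
  by rewrite mulr1 (zr _ _ _ tj) scalerA mulVf // scale1r.
- rewrite eqxx (@ifF _ (I i == s)); last by apply: ltn_eqF.
  by rewrite mul1r (zc _ _ _ si).
- rewrite (@ifF _ (J j == t)); last by apply: gtn_eqF.
  rewrite (@ifF _ (I i == s)); last by apply: ltn_eqF.
  by rewrite mulr1 scale1r (za _ _ _ _ si tj).
Qed.

Let nextP (k : nat) (kr : (k.+1 < r.+1)%N) :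
  [/\ Ordinal kr = (Ordinal (ltnW kr)).+1 :> nat,
      I (Ordinal kr) = (I (Ordinal (ltnW kr))).+1 :> nat
    & J (Ordinal kr) = (J (Ordinal (ltnW kr))).+1 :> nat].
Proof. by split=> //; [apply: Icons | apply: Jcons]. Qed.

(** The derivation of [row_killed] maps one rule to the next and leaves the
    scalar unchanged. *)
Lemma row_move c down k (kr : (k.+1 < r.+1)%N) t :
  let s := if down then Ordinal (ltnW kr) else Ordinal kr in
  let s' := if down then Ordinal kr else Ordinal (ltnW kr) in
  q_commute c M (Z (I s) t) -> q_commute c M (Z (I s') t).
Proof.
move=> s s' Mc; have [h1 h2 h3] := nextP kr.
have [kk [e [ke kM eM eZ]]] := row_killed q0 down h1 h2 I_inj J_inc.
by rewrite -eZ; apply: (skew_transfer ke kM eM Mc).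
Qed.

Lemma col_move c down k (kr : (k.+1 < r.+1)%N) i :
  let s := if down then Ordinal (ltnW kr) else Ordinal kr in
  let s' := if down then Ordinal kr else Ordinal (ltnW kr) in
  q_commute c M (Z i (J s)) -> q_commute c M (Z i (J s')).
Proof.
move=> s s' Mc; have [h1 h2 h3] := nextP kr.
have [kk [e [ke kM eM eZ]]] := col_killed q0 I down h1 h3 J_inj.
by rewrite -eZ; apply: (skew_transfer ke kM eM Mc).
Qed.

Lemma box_range d (f : 'I_r.+1 -> 'I_d) (x : 'I_d) : consecutive f ->
  (f ord0 <= x)%N -> (x <= f ord_max)%N -> exists k, x = f k.
Proof.
move=> fP; rewrite (consecutiveE ord_max fP) => fx xf.
have kr : (x - f ord0 < r.+1)%N by move: xf => /=; lia.
exists (Ordinal kr); apply: val_inj; rewrite /= (consecutiveE _ fP) /=; lia.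
Qed.

Lemma ord_down_ind (P : 'I_r.+1 -> Prop) : P ord_max ->
  (forall k (kr : (k.+1 < r.+1)%N), P (Ordinal kr) -> P (Ordinal (ltnW kr))) ->
  forall k, P k.
Proof.
move=> Pmax Pstep k; move e : (r - k)%N => l.
elim: l k e => [|l IHl] k e.
  by have -> : k = ord_max by apply: val_inj => /=; have := ltn_ord k; lia.
have kr : (k.+1 < r.+1)%N by lia.
have := Pstep k kr; rewrite (_ : Ordinal (ltnW kr) = k); last exact: val_inj.
by apply; apply: IHl => /=; lia.
Qed.

Lemma ord_up_ind (P : 'I_r.+1 -> Prop) : P ord0 ->
  (forall k (kr : (k.+1 < r.+1)%N), P (Ordinal (ltnW kr)) -> P (Ordinal kr)) ->
  forall k, P k.
Proof.
move=> P0 Pstep [k]; elim: k => [|k IHk] kr; last exact/Pstep/IHk.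
by rewrite (_ : Ordinal kr = ord0) //; apply: val_inj.
Qed.

(** Start from the north-east corner of the box, where the factors of its row and
    column are inverse to each other. *)
Lemma minor_central i j : M * Z (I i) (J j) = Z (I i) (J j) * M.
Proof.
suff : q_commute 1 M (Z (I i) (J j)) by rewrite /q_commute scale1r.
elim/ord_up_ind: i => [|k kr]; last exact: (@row_move 1 true k kr).
elim/ord_down_ind: j => [|k kr]; last exact: (@col_move 1 false k kr).
have <- : ne_factor (I ord0) (J ord_max) = 1.
  rewrite /ne_factor (bigD1 ord0) //= eqxx big1 => [|i i0].
    rewrite (bigD1 ord_max) //= eqxx big1 => [|j j0]; first by rewrite !mulr1 mulfV.
    by rewrite (inj_eq J_inj) (negbTE j0).
  by rewrite (inj_eq I_inj) (negbTE i0).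
exact: north_east_commute.
Qed.

(** Points that are neither strictly north-west nor strictly south-east of the
    box can be reached from its north-east or from its south-west side. *)
Lemma minor_normal (s : 'I_m) (t : 'I_n) :
  ~~ ((s < I ord0)%N && (t < J ord0)%N) ->
  ~~ ((I ord_max < s)%N && (J ord_max < t)%N) ->
  exists2 c, c != 0 & q_commute c M (Z s t).
Proof.
have ne0 s' t' : ne_factor s' t' != 0.
  by rewrite mulf_neq0 //; apply/prodf_neq0 => i _; case: ifP;
    rewrite ?invr_eq0 ?oner_eq0.
have sw0 s' t' : sw_factor s' t' != 0.
  by rewrite mulf_neq0 //; apply/prodf_neq0 => i _; case: ifP;
    rewrite ?invr_eq0 ?oner_eq0.
have NE1 (s' : 'I_m) (t' : 'I_n) : (s' <= I ord_max)%N -> (J ord_max <= t')%N ->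
    exists2 c, c != 0 & q_commute c M (Z s' t').
  move=> sI tJ; case: (leqP s' (I ord0)) => [sI0|/ltnW sI0].
    by exists (ne_factor s' t'); rewrite ?ne0 //; apply: north_east_commute.
  have [k ->] := box_range Icons sI0 sI.
  exists (ne_factor (I ord0) t'); first exact: ne0.
  elim/ord_up_ind: k => [|k kr]; first by apply: north_east_commute.
  exact: (@row_move _ true k kr).
have NE (s' : 'I_m) (t' : 'I_n) : (s' <= I ord_max)%N -> (J ord0 <= t')%N ->
    exists2 c, c != 0 & q_commute c M (Z s' t').
  move=> sI tJ; case: (leqP (J ord_max) t') => [|/ltnW tJm]; first exact: NE1.
  have [k ->] := box_range Jcons tJ tJm.
  have [c c0 h] := NE1 s' (J ord_max) sI (leqnn _); exists c => //.
  elim/ord_down_ind: k => [|k kr] //; exact: (@col_move _ false k kr).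
have SW1 (s' : 'I_m) (t' : 'I_n) : (I ord0 <= s')%N -> (t' <= J ord0)%N ->
    exists2 c, c != 0 & q_commute c M (Z s' t').
  move=> sI tJ; case: (leqP (I ord_max) s') => [sI0|/ltnW sI0].
    by exists (sw_factor s' t'); rewrite ?sw0 //; apply: south_west_commute.
  have [k ->] := box_range Icons sI sI0.
  exists (sw_factor (I ord_max) t'); first exact: sw0.
  elim/ord_down_ind: k => [|k kr]; first by apply: south_west_commute.
  exact: (@row_move _ false k kr).
have SW (s' : 'I_m) (t' : 'I_n) : (I ord0 <= s')%N -> (t' <= J ord_max)%N ->
    exists2 c, c != 0 & q_commute c M (Z s' t').
  move=> sI tJ; case: (leqP t' (J ord0)) => [|/ltnW tJm]; first exact: SW1.
  have [k ->] := box_range Jcons tJm tJ.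
  have [c c0 h] := SW1 s' (J ord0) sI (leqnn _); exists c => //.
  elim/ord_up_ind: k => [|k kr] //; exact: (@col_move _ true k kr).
have I0m : (I ord0 <= I ord_max)%N by rewrite (IE ord_max) leq_addr.
have J0m : (J ord0 <= J ord_max)%N by rewrite (JE ord_max) leq_addr.
rewrite !negb_and -!leqNgt => /orP[h1|h1] /orP[h2|h2]; [|exact: SW|exact: NE|].
- case: (leqP (J ord0) t) => [|/ltnW] h3; first exact: NE.
  exact: SW h1 (leq_trans h3 J0m).
- case: (leqP s (I ord_max)) => [|/ltnW] h3; first exact: NE.
  exact: SW (leq_trans I0m h3) h2.
Qed.
End Box.
End MinorNormal.

(** * Expansion along the first row *)

Lemma perm_length_lift r (s : 'S_r) :
  perm_length (lift_perm ord0 ord0 s) = perm_length s.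
Proof.
pose f (x : 'I_r * 'I_r) := (lift ord0 x.1, lift ord0 x.2).
have f_inj : injective f by move=> [a b] [a' b'] [/val_inj -> /val_inj ->].
rewrite /perm_length -(card_imset _ f_inj); apply: eq_card => -[x y].
rewrite inE /=; apply/idP/imsetP => [|[[a b]]]; last first.
  by rewrite inE /= => /andP[ab sab] [-> ->];
    rewrite !lift_perm_lift !lift0 !ltnS ab.
case: (unliftP ord0 y) => [b ->|->]; last by rewrite ltn0.
case: (unliftP ord0 x) => [a ->|->]; last by rewrite lift_perm_id.
rewrite !lift_perm_lift => h; exists (a, b) => //.
by move: h; rewrite inE !lift0 !ltnS.
Qed.

Lemma lift_perm_bij r :
  {on [pred s : 'S_r.+1 | s ord0 == ord0], bijective (lift_perm ord0 ord0)}.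
Proof.
pose g (s : 'S_r.+1) k := odflt k (unlift (s ord0) (s (lift ord0 k))).
have gK (s : 'S_r.+1) k : lift (s ord0) (g s k) = s (lift ord0 k).
  rewrite /g; have := neq_lift ord0 k.
  by rewrite -(can_eq (permK s)) => /unlift_some[] ? ? ->.
have g_inj (s : 'S_r.+1) : injective (g s).
  move=> k l /(congr1 (lift (s ord0))); rewrite !gK.
  by move=> /perm_inj /lift_inj.
exists (fun s => perm (@g_inj s)) => [s _|s].
  by apply/permP => k; rewrite permE /g lift_perm_lift lift_perm_id liftK.
rewrite inE => /eqP s0; apply/permP => k.
case: (unliftP ord0 k) => [k'|] ->; rewrite ?lift_perm_id //.
by rewrite lift_perm_lift permE -gK s0.
Qed.

Section Expansion.
Variables (F : fieldType) (q : F) (m n : nat).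
Hypothesis q0 : q != 0.
Local Notation O := (Oq q m n).
Local Notation p := (q ^+ 2).
Local Notation Z := (Z q).

Let p0 : p != 0. Proof. exact: expf_neq0. Qed.

(** The terms of the minor that avoid its upper left entry. *)
Definition minor_tail r (I : 'I_r.+1 -> 'I_m) (J : 'I_r.+1 -> 'I_n) : O :=
  \sum_(s : 'S_r.+1 | s ord0 != ord0)
    (- p) ^+ perm_length s *: \prod_(k < r.+1) Z (I k) (J (s k)).

Definition beheaded r T (f : 'I_r.+1 -> T) : 'I_r -> T := fun k => f (lift ord0 k).

Lemma minor_expand r (I : 'I_r.+1 -> 'I_m) (J : 'I_r.+1 -> 'I_n) :
  qminor q I J = Z (I ord0) (J ord0) * qminor q (beheaded I) (beheaded J)
    + minor_tail I J.
Proof.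
rewrite /qminor (bigID (fun s : 'S_r.+1 => s ord0 == ord0)) /=; congr (_ + _).
rewrite (reindex _ (@lift_perm_bij r)) mulr_sumr; apply: eq_big => [s|s _].
  by rewrite lift_perm_id eqxx.
rewrite -scalerAr perm_length_lift big_ord_recl lift_perm_id; congr (_ *: (_ * _)).
by apply: eq_bigr => k _; rewrite lift_perm_lift.
Qed.

Lemma minor_size0 (I : 'I_0 -> 'I_m) (J : 'I_0 -> 'I_n) : qminor q I J = 1.
Proof.
rewrite /qminor (bigD1 1%g) //= [X in _ + X]big1 => [|s].
  rewrite big_ord0 addr0 /perm_length (_ : [set p | _] = set0) ?cards0 ?expr0
    ?scale1r //.
  by apply/setP => -[[]].
by move/eqP; case; apply/permP => -[].
Qed.

(** Put an oscillator block in the upper left 2 x 2 corner of the box and the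
    identity elsewhere. The smaller minor then acts on the vacuum as [lower],
    that is, by 0, while in the tail only the transposition of the first two
    columns survives and acts by a nonzero scalar. *)
Lemma tail_not_multiple r (I : 'I_r.+2 -> 'I_m) (J : 'I_r.+2 -> 'I_n) (g : O) :
  consecutive I -> consecutive J ->
  minor_tail I J <> g * qminor q (beheaded I) (beheaded J).
Proof.
move=> Icons Jcons.
have IE k : I k = (I ord0 + k)%N :> nat by apply: consecutiveE.
have JE k : J k = (J ord0 + k)%N :> nat by apply: consecutiveE.
pose c := (I ord0 + J ord0)%N.
pose X := raise F tt; pose K := scale p tt; pose D := lower p tt.
have [f fZ] := oq_lift (elementary_qmx (oscillator p0 tt) c (J ord0) (I ord0) m n).
pose v := @vacuum F unit.
have Kv : K v = v.
  apply/funext => e; rewrite scaleE /v /vacuum; case: asboolP => [->|_].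
    by rewrite expr0 invr1 mul1r.
  by rewrite mulr0.
have Dv : D v = 0.
  apply/funext => e; rewrite lowerE /v /vacuum; case: asboolP => [h|_];
    last by rewrite mulr0.
  by have := congr1 (fun e => e tt) h; rewrite upd_same.
have fZE k l : f (Z (I k) (J l)) = elementary X K K D 0 k l.
  by rewrite fZ (IE k) (JE l) !addnA [(J ord0 + I ord0)%N]addnC elementary_shift.
pose l2 (k : 'I_r) : 'I_r.+2 := lift ord0 (lift ord0 k).
have fl2 k l : f (Z (I (l2 k)) (J l)) = (l2 k == l)%:R.
  by rewrite fZE /elementary -val_eqE [nat_of_ord (l2 k)]lift0 lift0.
have tail_id : (\prod_(k < r) f (Z (I (l2 k)) (J (l2 k)))) v = v.
  by rewrite big1 ?endo_oneE // => k _; rewrite fl2 eqxx.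
have tail_id_or_0 (h : 'I_r -> 'I_r.+2) :
    let w := (\prod_(k < r) f (Z (I (l2 k)) (J (h k)))) v in w = v \/ w = 0.
  elim/big_rec: _ => [|k u _]; first by left.
  rewrite endo_mulE fl2; case: (_ == _); rewrite ?endo_oneE ?endo_zeroE //.
  by right.
pose N := qminor q (beheaded I) (beheaded J).
have fN : f N v = 0.
  rewrite /N /qminor linear_sum endo_sumE big1 // => s _.
  rewrite linearZ endo_scaleE rmorph_prod big_ord_recl endo_mulE /beheaded.
  have [->|->] := tail_id_or_0 (fun k => lift ord0 (s (lift ord0 k))).
    rewrite /= fZE /elementary !lift0 /=.
    by case: eqP => _; rewrite ?Dv ?endo_zeroE scaler0.
  by rewrite endo0 scaler0.
move=> /(congr1 (fun a => f a v)); rewrite rmorphM endo_mulE fN endo0.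
have f01 : f (Z (I ord0) (J (lift ord0 ord0))) = K by rewrite fZE.
have f10 : f (Z (I (lift ord0 ord0)) (J ord0)) = K by rewrite fZE.
pose t := tperm ord0 (lift ord0 ord0 : 'I_r.+2).
have t0 : t ord0 = lift ord0 ord0 by rewrite tpermL.
have t1 : t (lift ord0 ord0) = ord0 by rewrite tpermR.
have t2 k : t (l2 k) = l2 k by rewrite tpermD.
rewrite /minor_tail linear_sum endo_sumE (bigD1 t) /= ?t0 // [X in _ + X]big1
  ?addr0.
  rewrite linearZ endo_scaleE rmorph_prod !big_ord_recl !endo_mulE t0 t1.
  under eq_bigr do rewrite t2.
  rewrite [X in _ *: _ (_ X)]tail_id /= f01 f10 !Kv => /eqP.
  rewrite scaler_eq0 expf_eq0 oppr_eq0 (negbTE p0) andbF /=.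
  by rewrite (negbTE (vacuum_neq0 F unit)).
move=> s /andP[s0 st]; rewrite linearZ endo_scaleE rmorph_prod.
suff -> : (\prod_k f (Z (I k) (J (s k)))) v = 0 by rewrite scaler0.
rewrite !big_ord_recl !endo_mulE.
set l1 := lift ord0 ord0 in t0 t1 *.
have [s01|s01] := eqVneq (s ord0) l1; last first.
  rewrite [f (Z (I ord0) _)]fZE /elementary /= (_ : (s ord0 == 0%N :> nat) = false).
    by rewrite (_ : (s ord0 == 1%N :> nat) = false) //; apply: negbTE.
  exact: negbTE.
have s11 : s l1 != l1 by rewrite -s01 (inj_eq perm_inj).
have [s10|s10] := eqVneq (s l1) ord0; last first.
  rewrite [f (Z (I l1) _)]fZE /elementary /= (_ : (s l1 == 0%N :> nat) = false).
    by rewrite (_ : (s l1 == 1%N :> nat) = false) ?endo0 //; apply: negbTE.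
  exact: negbTE.
have [k sk] : exists k, s (l2 k) != l2 k.
  apply/existsP; apply: contraNT st; rewrite negb_exists => /forallP s2.
  apply/eqP/permP => k; case: (unliftP ord0 k) => [k1 ->|->];
    last by rewrite s01 t0.
  case: (unliftP ord0 k1) => [k2 ->|->]; last by rewrite s10 t1.
  by rewrite t2; apply/eqP; have := s2 k2; rewrite negbK.
rewrite (_ : (\prod_(i < r) _) = 0) ?endo_zeroE ?endo0 //.
by apply: (@prod_eq0 _ _ _ k); rewrite fl2 eq_sym (negbTE sk).
Qed.
End Expansion.

(** * Prime elements in an Ore extension *)

Section OreStep.
Variables (R : nzRingType) (B : {pred R}) (x : R) (tau : R -> R).
Hypothesis hB : subring_closed B.
Hypothesis tauB : forall b, b \in B -> tau b \in B.
Hypothesis Bx : forall b, b \in B -> b * x - x * tau b \in B.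

Definition deg_lt d (a : R) :=
  exists2 f : nat -> R, forall i, f i \in B & a = \sum_(i < d) x ^+ i * f i.

(* Freeness over [B], in the form in which leading coefficients use it. *)
Hypothesis top_free : forall d b a, b \in B -> deg_lt d a ->
  x ^+ d * b + a = 0 -> b = 0.

Let B1 : 1 \in B. Proof. by case: hB. Qed.
Let BB a b : a \in B -> b \in B -> a - b \in B.
Proof. by case: hB => _ h _; apply: h. Qed.
Let BM a b : a \in B -> b \in B -> a * b \in B.
Proof. by case: hB => _ _; apply. Qed.
Let B0 : 0 \in B. Proof. by rewrite -(subrr 1) BB. Qed.
Let BX a k : a \in B -> a ^+ k \in B.
Proof. by move=> Ba; elim: k => // k IHk; rewrite exprS BM. Qed.

Lemma deg_lt_zero d : deg_lt d 0.
Proof. by exists (fun=> 0) => //; rewrite big1 // => i _; rewrite mulr0. Qed.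
Lemma deg_ltB d a a' : deg_lt d a -> deg_lt d a' -> deg_lt d (a - a').
Proof.
move=> [f fB ->] [g gB ->]; exists (fun i => f i - g i); first by move=> i;
  apply: BB.
by rewrite -sumrB; apply: eq_bigr => i _; rewrite mulrBr.
Qed.
Lemma deg_ltN d a : deg_lt d a -> deg_lt d (- a).
Proof. by move=> la; rewrite -sub0r; apply: deg_ltB => //; apply: deg_lt_zero. Qed.
Lemma deg_ltD d a a' : deg_lt d a -> deg_lt d a' -> deg_lt d (a + a').
Proof.
by move=> la la'; rewrite -[a']opprK; apply: deg_ltB => //; apply: deg_ltN.
Qed.

Lemma deg_lt_rcons d b a : b \in B -> deg_lt d a -> deg_lt d.+1 (x ^+ d * b + a).
Proof.
move=> Bb [f fB ->]; exists (fun i => if (i < d)%N then f i else b).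
  by move=> i; case: ifP.
rewrite big_ord_recr /= ltnn addrC; congr (_ + _).
by apply: eq_bigr => i _; rewrite ltn_ord.
Qed.

Lemma deg_lt_recr d a : deg_lt d.+1 a ->
  exists b a', [/\ b \in B, deg_lt d a' & a = x ^+ d * b + a'].
Proof.
move=> [f fB ->]; exists (f d), (\sum_(i < d) x ^+ i * f i); split=> //;
  first by exists f.
by rewrite big_ord_recr addrC.
Qed.

Lemma deg_lt_recl d a : deg_lt d.+1 a ->
  exists b a', [/\ b \in B, deg_lt d a' & a = b + x * a'].
Proof.
move=> [f fB ->]; exists (f 0%N), (\sum_(i < d) x ^+ i * f i.+1); split=> //.
  by exists (f \o succn) => // i /=.
rewrite big_ord_recl mul1r mulr_sumr; congr (_ + _).
by apply: eq_bigr => i _; rewrite mulrA -exprS.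
Qed.

Lemma deg_lt_succ d a : deg_lt d a -> deg_lt d.+1 a.
Proof. by move=> la; have := deg_lt_rcons B0 la; rewrite mulr0 add0r. Qed.

Lemma deg_lt_leq d e a : (d <= e)%N -> deg_lt d a -> deg_lt e a.
Proof. by move=> /subnK <- la; elim: (e - d)%N => // k; apply: deg_lt_succ. Qed.

Lemma deg_lt_const b d : b \in B -> deg_lt d.+1 b.
Proof.
move=> Bb; apply: (@deg_lt_leq 1) => //.
by have := deg_lt_rcons Bb (deg_lt_zero 0); rewrite mul1r addr0.
Qed.

Lemma deg_lt_mono d b e : b \in B -> (d < e)%N -> deg_lt e (x ^+ d * b).
Proof.
by move=> Bb de; apply: (deg_lt_leq de); rewrite -[_ * _]addr0;
  apply/deg_lt_rcons/deg_lt_zero.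
Qed.

Lemma deg_lt_mulr d a b : deg_lt d a -> b \in B -> deg_lt d (a * b).
Proof.
move=> [f fB ->] Bb; exists (fun i => f i * b); first by move=> i; apply: BM.
by rewrite mulr_suml; apply: eq_bigr => i _; rewrite mulrA.
Qed.

Lemma deg_lt_mulxl d a k : deg_lt d a -> deg_lt (k + d) (x ^+ k * a).
Proof.
elim: d a => [|d IHd] a; first by case=> f _ ->; rewrite big_ord0 mulr0;
  apply: deg_lt_zero.
move=> /deg_lt_recr[b [a' [Bb la' ->]]]; rewrite mulrDr mulrA -exprD addnS.
exact/deg_lt_rcons/IHd.
Qed.

Lemma deg_lt_mulx d a : deg_lt d a -> deg_lt d.+1 (a * x).
Proof.
elim: d a => [|d IHd] a; first by case=> f _ ->; rewrite big_ord0 mul0r;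
  apply: deg_lt_zero.
move=> /deg_lt_recr[b [a' [Bb la' ->]]]; rewrite mulrDl; apply: deg_ltD;
  last exact/deg_lt_succ/IHd.
rewrite -mulrA -[b * x](subrK (x * tau b)) mulrDr mulrA -exprSr.
by apply: deg_ltD; apply: deg_lt_mono; rewrite ?Bx ?tauB.
Qed.

Lemma deg_lt_mulX d a k : deg_lt d a -> deg_lt (d + k) (a * x ^+ k).
Proof.
move=> la; elim: k => [|k IHk]; first by rewrite addn0 mulr1.
by rewrite exprSr mulrA addnS; apply: deg_lt_mulx.
Qed.

Lemma iter_tauB e b : b \in B -> iter e tau b \in B.
Proof. by move=> Bb; elim: e => //= e; apply: tauB. Qed.

Lemma tau_pow b e : b \in B -> deg_lt e (b * x ^+ e - x ^+ e * iter e tau b).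
Proof.
move=> Bb; elim: e => [|e IHe]; first by rewrite mulr1 mul1r subrr;
  apply: deg_lt_zero.
set t := iter e tau b in IHe *.
have -> : b * x ^+ e.+1 - x ^+ e.+1 * iter e.+1 tau b =
    (b * x ^+ e - x ^+ e * t) * x + x ^+ e * (t * x - x * tau t).
  rewrite mulrBl mulrBr !exprSr !mulrA addrA subrK; congr (_ - _).
apply: deg_ltD; first exact: deg_lt_mulx.
by apply: deg_lt_mono => //; apply/Bx/iter_tauB.
Qed.

Lemma deg_lt_mull d a b : b \in B -> deg_lt d a -> deg_lt d (b * a).
Proof.
move=> Bb; elim: d a => [|d IHd] a; first by case=> f _ ->;
  rewrite big_ord0 mulr0; apply: deg_lt_zero.
move=> /deg_lt_recr[b' [a' [Bb' la' ->]]]; rewrite mulrDr; apply: deg_ltD;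
  last exact/deg_lt_succ/IHd.
rewrite mulrA -[b * _](subrK (x ^+ d * iter d tau b)) mulrDl; apply: deg_ltD.
  exact/deg_lt_succ/deg_lt_mulr/Bb'/tau_pow.
by rewrite -mulrA; apply: deg_lt_mono => //; apply/BM/Bb'/iter_tauB.
Qed.

Lemma deg_lt_mul d e a a' : deg_lt d a -> deg_lt e a' -> deg_lt (d + e) (a * a').
Proof.
elim: d a => [|d IHd] a la la'.
  by case: la => f _ ->; rewrite big_ord0 mul0r; apply: deg_lt_zero.
have [b [a1 [Bb la1 ->]]] := deg_lt_recr la; rewrite mulrDl; apply: deg_ltD.
  rewrite -mulrA addSn -addnS; apply/deg_lt_mulxl/deg_lt_succ; exact: deg_lt_mull.
by apply: deg_lt_leq (IHd _ la1 la'); rewrite leq_add2r.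
Qed.

(** Leading coefficients multiply up to the twist [tau]. *)
Lemma lead_mul d e b b' a a' : b \in B -> b' \in B -> deg_lt d a -> deg_lt e a' ->
  exists2 c, deg_lt (d + e) c &
    (x ^+ d * b + a) * (x ^+ e * b' + a') = x ^+ (d + e) * (iter e tau b * b') + c.
Proof.
move=> Bb Bb' la la'.
exists (x ^+ d * (b * x ^+ e - x ^+ e * iter e tau b) * b'
   + (x ^+ d * (b * a') + (a * x ^+ e * b' + a * a'))).
  apply: deg_ltD; first exact/deg_lt_mulr/Bb'/deg_lt_mulxl/tau_pow.
  apply: deg_ltD; first exact/deg_lt_mulxl/deg_lt_mull.
  apply: deg_ltD; last exact: deg_lt_mul.
  exact/deg_lt_mulr/Bb'/deg_lt_mulX.
have -> : (x ^+ d * b + a) * (x ^+ e * b' + a') =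
    x ^+ d * b * (x ^+ e * b') + (x ^+ d * (b * a') + (a * x ^+ e * b' + a * a')).
  by rewrite mulrDl !mulrDr -!addrA !mulrA.
rewrite [RHS]addrA; congr (_ + _).
by rewrite mulrBr mulrBl exprD !mulrA addrC subrK.
Qed.

Definition ore_ext a := exists d, deg_lt d a.

Lemma oreB a a' : ore_ext a -> ore_ext a' -> ore_ext (a - a').
Proof.
move=> [d la] [e le]; exists (maxn d e).
by apply: deg_ltB; [apply: deg_lt_leq la | apply: deg_lt_leq le];
  rewrite ?leq_maxl ?leq_maxr.
Qed.
Lemma oreM a a' : ore_ext a -> ore_ext a' -> ore_ext (a * a').
Proof. by move=> [d la] [e le]; exists (d + e)%N; apply: deg_lt_mul. Qed.
Lemma ore_const b : b \in B -> ore_ext b.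
Proof. by move=> Bb; exists 1%N; apply: deg_lt_const. Qed.
Lemma ore_x : ore_ext x.
Proof. by exists 2%N; have := @deg_lt_mono 1 1 2 B1 isT; rewrite mulr1. Qed.

(** The common part of three arguments by leading coefficients: [J] is an ideal
    of the extension whose leading coefficients lie in the ideal [Q] of [B].
    With [Q] zero this shows that the extension is a domain. *)
Section PrimeIdeal.
Variables (J Q : R -> Prop).
Hypotheses (J0 : J 0) (JB : forall a a', J a -> J a' -> J (a - a')).
Hypothesis JMr : forall a c, J a -> ore_ext c -> J (a * c).
Hypothesis JMl : forall a c, J a -> ore_ext c -> J (c * a).
Hypothesis QJ : forall d b, b \in B -> Q b -> J (x ^+ d * b).
Hypothesis J_lead : forall d b a, b \in B -> deg_lt d a ->
  J (x ^+ d * b + a) -> Q b.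
Hypothesis Q_prime : forall e b b', b \in B -> b' \in B ->
  Q (iter e tau b * b') -> Q b \/ Q b'.

Lemma ore_prime a a' : ore_ext a -> ore_ext a' -> J (a * a') -> J a \/ J a'.
Proof.
move=> [d la] [e le]; move: {2}(d + e)%N (leqnn (d + e)) => k.
elim: k d e a a' la le => [|k IHk] [|d] [|e] a a' la le //= dek Jaa';
  try by left; case: la => f _ ->; rewrite big_ord0.
  by right; case: le => f _ ->; rewrite big_ord0.
have [b [a1 [Bb la1 aE]]] := deg_lt_recr la.
have [b' [a1' [Bb' la1' aE']]] := deg_lt_recr le.
have [c lc] := lead_mul Bb Bb' la1 la1'; rewrite -aE -aE' => prodE.
have lead : Q (iter e tau b * b').
  by apply: J_lead lc _; [apply/BM/Bb'/iter_tauB | rewrite -prodE].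
have Ob : ore_ext (x ^+ d * b) by exists d.+1; apply: deg_lt_mono.
have Ob' : ore_ext (x ^+ e * b') by exists e.+1; apply: deg_lt_mono.
have JD u v : J u -> J v -> J (u + v).
  by move=> Ju Jv; rewrite -[v]opprK -[- v]sub0r; apply/JB/JB.
case: (Q_prime Bb Bb' lead) => [Qb|Qb'].
  have Jb := QJ d Bb Qb; have a1E : a1 = a - x ^+ d * b by rewrite aE addrC addKr.
  have [||Ja1|Ja'] := IHk _ _ a1 a' la1 le; [by rewrite addSn in dek| | |by right].
    by rewrite a1E mulrBl; apply: JB => //; apply: JMr => //; exists e.+1.
  by left; rewrite aE; apply: JD.
have Jb' := QJ e Bb' Qb';
  have a1E : a1' = a' - x ^+ e * b' by rewrite aE' addrC addKr.
have [||Ja|Ja1] := IHk _ _ a a1' la la1'; [by rewrite addnS in dek| |by left|].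
  by rewrite a1E mulrBr; apply: JB => //; apply: JMl => //; exists d.+1.
by right; rewrite aE'; apply: JD.
Qed.
End PrimeIdeal.

Hypothesis B_dom : forall a b, a \in B -> b \in B -> a * b = 0 -> a = 0 \/ b = 0.
Hypothesis tau_inj : forall b, b \in B -> tau b = 0 -> b = 0.

Lemma iter_tau0 e b : b \in B -> iter e tau b = 0 -> b = 0.
Proof. by move=> Bb; elim: e => //= e IHe /(tau_inj (iter_tauB e Bb)). Qed.

Lemma ore_domain a a' : ore_ext a -> ore_ext a' -> a * a' = 0 -> a = 0 \/ a' = 0.
Proof.
apply: (@ore_prime (fun a => a = 0) (fun b => b = 0)) => //.
- by move=> u v -> ->; rewrite subr0.
- by move=> u v -> _; rewrite mul0r.
- by move=> u v -> _; rewrite mulr0.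
- by move=> d b _ ->; rewrite mulr0.
- by move=> e b b' Bb Bb' /(B_dom (iter_tauB e Bb) Bb')[/(iter_tau0 Bb)|];
  [left|right].
Qed.

Definition multiple (S : R -> Prop) (M a : R) := exists2 f, S f & a = f * M.
Local Notation inB := (fun b => b \in B).

(** Multiplying by an element of [B] from the right acts on each coefficient
    separately. *)
Lemma multiple_lead M d b a : M \in B -> M != 0 -> b \in B -> deg_lt d a ->
  multiple ore_ext M (x ^+ d * b + a) -> multiple inB M b.
Proof.
move=> BM_ M0 Bb la [f [k lf] fM].
have M_reg g : g \in B -> g * M = 0 -> g = 0.
  by move=> Bg /(B_dom Bg BM_)[//|M00]; rewrite M00 eqxx in M0.
elim: k f lf fM => [|k IHk] f lf fM.
  exists 0 => //; rewrite mul0r; apply: (top_free Bb la).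
  by rewrite fM; case: lf => g _ ->; rewrite big_ord0 mul0r.
have [g [f1 [Bg lf1 fE]]] := deg_lt_recr lf.
case: (ltngtP k d) => [kd|dk|kd].
- exists 0 => //; rewrite mul0r; apply: (@top_free d _ (a - f * M)) => //.
    by apply: deg_ltB => //; apply: (deg_lt_leq kd); apply: deg_lt_mulr.
  by rewrite addrA fM subrr.
- suff g0 : g = 0 by apply: (IHk f1) => //; rewrite fM fE g0 mulr0 add0r.
  apply/(M_reg _ Bg)/(@top_free k _ (f1 * M - (x ^+ d * b + a))); first exact: BM.
    apply: deg_ltB; first exact: deg_lt_mulr.
    by apply: deg_ltD; [apply: deg_lt_mono | apply: deg_lt_leq la; apply: ltnW].
  by rewrite fM fE mulrDl -mulrA addrA subrr.
- exists g => //; apply/eqP; rewrite -subr_eq0; apply/eqP.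
  apply: (@top_free d _ (a - f1 * M)); first by apply: BB => //; apply: BM.
    by apply: deg_ltB => //; rewrite -kd; apply: deg_lt_mulr.
  by rewrite mulrBr addrACA fM fE mulrDl -kd -mulrA -opprD subrr.
Qed.

Definition prime_element (S : R -> Prop) (M : R) : Prop :=
  [/\ M != 0, ~ multiple S M 1
    & forall a b, S a -> S b -> multiple S M (a * b) ->
        multiple S M a \/ multiple S M b].

Definition normal (S : R -> Prop) (M : R) : Prop :=
  (forall a, S a -> exists2 a', S a' & M * a = a' * M) /\
  (forall a, S a -> exists2 a', S a' & a * M = M * a').

Section Extend.
Variable M : R.
Hypotheses (M_normal : normal ore_ext M).
Local Notation J := (multiple ore_ext M).

Let ore0 : ore_ext 0. Proof. by exists 0%N; apply: deg_lt_zero. Qed.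
Let J0 : J 0. Proof. by exists 0; rewrite ?mul0r. Qed.
Let JB a a' : J a -> J a' -> J (a - a').
Proof.
move=> [f Of ->] [g Og ->]; exists (f - g); [exact: oreB | by rewrite mulrBl].
Qed.
Let JMr a c : J a -> ore_ext c -> J (a * c).
Proof.
move=> [f Of ->] Oc; have [c' Oc' cE] := M_normal.1 c Oc.
by exists (f * c'); [exact: oreM | rewrite -!mulrA cE].
Qed.
Let JMl a c : J a -> ore_ext c -> J (c * a).
Proof. by move=> [f Of ->] Oc; exists (c * f); [exact: oreM | rewrite mulrA]. Qed.

Lemma prime_element_extend : M \in B -> prime_element inB M ->
  (forall b, b \in B -> multiple inB M (tau b) -> multiple inB M b) ->
  prime_element ore_ext M.
Proof.
move=> BM_ [M0 M1 Mprime] Mtau; split=> //.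
  move=> J1; apply: M1; apply: (@multiple_lead M 0 1 0 BM_ M0 B1 (deg_lt_zero 0)).
  by rewrite mulr1 addr0.
have Mtau_iter e b : b \in B -> multiple inB M (iter e tau b) -> multiple inB M b.
  by move=> Bb; elim: e => //= e IHe /(Mtau _ (iter_tauB e Bb)).
move=> a b; apply: (@ore_prime J (multiple inB M)) => //.
- move=> d c _ [g Bg ->]; exists (x ^+ d * g); last by rewrite mulrA.
  by exists d.+1; apply: deg_lt_mono.
- by move=> d c u Bc lu; apply: multiple_lead.
- by move=> e c c' Bc Bc' /(Mprime _ _ (iter_tauB e Bc) Bc')[/(Mtau_iter _ _
  Bc)|]; [left|right].
Qed.

(** The element [M = x * N + c] of degree one. The alternative [N = 1] covers
    boxes of size one. *)
Section Adjoin.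
Variables (N c : R).
Hypotheses (BN_ : N \in B) (Bc : c \in B) (N0 : N != 0) (ME : M = x * N + c).
Hypothesis N_normal : normal inB N.
Hypothesis NM : exists2 u, ore_ext u & N * M = u * (M * N).
Hypothesis N_reg : N = 1 \/ (prime_element inB N /\ ~ multiple inB N c).

Let M0 : M != 0.
Proof.
apply: contraNneq N0 => M00; apply/eqP; apply: (@top_free 1 N c) => //;
  first exact: deg_lt_const.
by rewrite -M00 ME.
Qed.

Let oreN : ore_ext N. Proof. exact: ore_const. Qed.

(** [f * c] has coefficients [f_i * c], and [N] is prime and does not divide
    [c]. *)
Lemma right_coef_regular d f : deg_lt d f -> multiple ore_ext N (f * c) ->
  multiple ore_ext N f.
Proof.
case: N_reg => [->|[[_ _ Nprime] cN]]; first by move=> lf _; exists f;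
  rewrite ?mulr1 //; exists d.
elim: d f => [|d IHd] f; first by case=> g _ ->; rewrite big_ord0 => _;
  exists 0; rewrite ?mul0r.
move=> /deg_lt_recr[b [f1 [Bb lf1 ->]]]; rewrite mulrDl -mulrA => fc.
have : multiple inB N (b * c).
  by apply: (multiple_lead BN_ N0 _ _ fc); [apply: BM | apply: deg_lt_mulr].
case/(Nprime _ _ Bb Bc) => // -[g Bg gE].
have [c' Bc' cE] := N_normal.1 c Bc.
have Oxg h : h \in B -> ore_ext (x ^+ d * h) by move=> Bh; exists d.+1;
  apply: deg_lt_mono.
have /(IHd _ lf1)[f2 Of2 f2E] : multiple ore_ext N (f1 * c).
  case: fc => h Oh hE; exists (h - x ^+ d * (g * c')).
    by apply: oreB => //; apply/Oxg/BM.
  by rewrite mulrBl -hE gE -!mulrA cE addrAC subrr add0r.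
exists (x ^+ d * g - (0 - f2)); first by do 2?apply: oreB => //; apply: Oxg.
by rewrite sub0r opprK mulrDl -mulrA -gE -f2E.
Qed.

(** If [a * N = f * M], then [f * c] is a multiple of [N], hence so is [f], and
    [N] cancels. *)
Lemma right_regular a : ore_ext a -> J (a * N) -> J a.
Proof.
move=> Oa [f Of fE]; have [d lf] := Of.
have /(right_coef_regular lf)[g Og gE] : multiple ore_ext N (f * c).
  exists (a - f * x); first by apply: oreB => //; apply/oreM/ore_x.
  by rewrite mulrBl fE ME mulrDr mulrA addrC addKr.
have [u Ou NME] := NM; exists (g * u); first exact: oreM.
apply/eqP; rewrite -subr_eq0; apply/eqP.
have : (a - g * u * M) * N = 0.
  by rewrite mulrBl fE gE -!mulrA NME subrr.
move=> /ore_domain[||//|N00]; last by move/eqP: N0.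
  by apply: oreB => //; do 2?apply: oreM => //; exists 2%N;
    rewrite ME -[x]expr1; apply/deg_lt_rcons/deg_lt_const.
exact: oreN.
Qed.

Lemma right_regularX a k : ore_ext a -> J (a * N ^+ k) -> J a.
Proof.
move=> Oa; elim: k => [|k IHk]; first by rewrite mulr1.
rewrite exprSr mulrA => /right_regular h; apply: IHk; apply: h.
by apply: oreM => //; apply/ore_const/BX.
Qed.

Lemma normalX b k : b \in B -> exists2 b', b' \in B & b * N ^+ k = N ^+ k * b'.
Proof.
elim: k b => [|k IHk] b Bb; first by exists b; rewrite ?mulr1 ?mul1r.
have [b1 Bb1 b1E] := N_normal.2 b Bb; have [b2 Bb2 b2E] := IHk b1 Bb1.
by exists b2; rewrite // !exprS mulrA b1E -!mulrA b2E.
Qed.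

(** Modulo [M] one has [x * N = - c], so a power of [N] removes all [x]. *)
Lemma clear_denominators a : ore_ext a ->
  exists k b, b \in B /\ J (a * N ^+ k - b).
Proof.
case=> d; elim: d a => [|d IHd] a.
  by case=> f _ ->; rewrite big_ord0; exists 0%N, 0; rewrite mul0r subr0.
move=> /deg_lt_recl[b0 [a' [Bb0 /IHd[k [b [Bb Jb]]] ->]]].
have [b' Bb' b'E] := N_normal.2 b Bb.
exists k.+1, (b0 * N ^+ k.+1 - c * b'); split; first by apply: BB;
  apply: BM => //; apply: BX.
have -> : (b0 + x * a') * N ^+ k.+1 - (b0 * N ^+ k.+1 - c * b') =
    x * (a' * N ^+ k - b) * N - (0 - M * b').
  rewrite sub0r opprK ME [(x * N + c) * b']mulrDl [RHS]addrA -[x * N * b']mulrA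
    -b'E.
  rewrite mulrBr mulrBl -!mulrA -exprSr subrK mulrDl opprB -!mulrA.
  by rewrite [b0 * _ + _]addrC -addrA [b0 * _ + _]addrC subrK.
apply: JB; first exact: (JMr (JMl Jb ore_x) oreN).
apply: JB => //; have [b'' Ob'' ->] := M_normal.1 b' (ore_const Bb').
by exists b''.
Qed.

(** A nonzero multiple of [M] has positive degree, its leading coefficient being
    a product of nonzero elements of the domain [B]. *)
Lemma multiple_const b : b \in B -> J b -> b = 0.
Proof.
move=> Bb [f [d lf] fE]; elim: d f lf fE => [|d IHd] f lf fE.
  by rewrite fE; case: lf => g _ ->; rewrite big_ord0 mul0r.
have [g [f1 [Bg lf1 fE1]]] := deg_lt_recr lf.
have [u lu] := lead_mul Bg BN_ lf1 (deg_lt_const 0 Bc).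
rewrite expr1 -ME -fE1 -fE => bE.
have /= Btg := iter_tauB 1 Bg.
have : tau g * N = 0.
  apply: (@top_free (d + 1) _ (u - b)); first exact: BM.
    by apply: deg_ltB => //; rewrite addn1; apply: deg_lt_const.
  by rewrite addrA -bE subrr.
case/(B_dom Btg BN_) => [/(tau_inj Bg) g0|N00]; last by move/eqP: N0.
by apply: (IHd f1) => //; rewrite fE fE1 g0 mulr0 add0r.
Qed.

(** Powers of [N] move two factors into [B] modulo [M]; their product is then a
    multiple of [M] in [B], hence 0, and [B] is a domain. *)
Lemma prime_element_adjoin : prime_element ore_ext M.
Proof.
split; [exact: M0 | by move=> /(multiple_const B1)/eqP; rewrite oner_eq0 |].
move=> a a' Oa Oa' Jaa'.
have [k [b [Bb Jb]]] := clear_denominators Oa.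
have [k' [b' [Bb' Jb']]] := clear_denominators Oa'.
have [b'' Bb'' b''E] := normalX k Bb'.
have ON j : ore_ext (N ^+ j) by apply/ore_const/BX.
have Jab' : J (a * b').
  have -> : a * b' = a * a' * N ^+ k' - a * (a' * N ^+ k' - b').
    by rewrite mulrBr mulrA opprB addrC subrK.
  by apply: JB; [apply: JMr | apply: JMl].
have : J (b * b'').
  have -> : b * b'' = a * b' * N ^+ k - (a * N ^+ k - b) * b''.
    by rewrite mulrBl -!mulrA b''E opprB addrC subrK.
  by apply: JB; apply: JMr => //; apply: ore_const.
move=> /(multiple_const (BM Bb Bb'')) /(B_dom Bb Bb'')[b0|b0].
  by left; apply: (@right_regularX a k) => //; rewrite -[_ * _]subr0 -b0.
right; apply: (@right_regularX a' k') => //.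
have b'0 : b' = 0.
  elim: (k) b''E => [|j IHj]; first by rewrite mulr1 b0 mulr0.
  rewrite b0 mulr0 exprSr mulrA => bN; apply: IHj; rewrite b0 mulr0.
  have := B_dom (BM Bb' (BX j BN_)) BN_ bN.
  by case=> // N00; move/eqP: N0.
by rewrite -[_ * _]subr0 -b'0.
Qed.

End Adjoin.
End Extend.

End OreStep.

(** * The algebra of an up-set *)

Section Torus.
Variables (F : fieldType) (q : F) (m n : nat).
Local Notation O := (Oq q m n).
Local Notation p := (q ^+ 2).
Local Notation Z := (Z q).

Lemma torus_action (la : 'I_m -> F) (mu : 'I_n -> F) :
  exists f : {lrmorphism O -> O}, forall i j, f (Z i j) = (la i * mu j) *: Z i j.
Proof.
apply: oq_lift; have [zr zc za zd] := Z_qmx q m n.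
have ZZ i j s t : ((la i * mu j) *: Z i j) * ((la s * mu t) *: Z s t) =
    ((la i * mu j) * (la s * mu t)) *: (Z i j * Z s t).
  by rewrite -scalerAl -scalerAr scalerA.
split=> [i j t jt|i s j ij|i s j t si jt|i s j t ij jt]; rewrite !ZZ.
- by rewrite (zr _ _ _ jt) !scalerA mulrC [in LHS](mulrC (la i * mu j)).
- by rewrite (zc _ _ _ ij) !scalerA mulrC [in LHS](mulrC (la i * mu j)).
- by rewrite (za _ _ _ _ si jt) [in LHS](mulrC (la i * mu j)).
- rewrite (zd _ _ _ _ ij jt) scalerDr !scalerA (mulrC (la s * mu t)).
  by rewrite [_ * (p - _)]mulrC (mulrACA (la i)) [mu j * mu t]mulrC
    -(mulrACA (la i)).
Qed.

(** Each monomial has one entry in each row and in each column. *)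
Lemma torus_minor (f : {lrmorphism O -> O}) la mu r
    (I : 'I_r -> 'I_m) (J : 'I_r -> 'I_n) :
  (forall i j, f (Z i j) = (la i * mu j) *: Z i j) ->
  f (qminor q I J) = ((\prod_k la (I k)) * \prod_k mu (J k)) *: qminor q I J.
Proof.
move=> fZ; rewrite linear_sum scaler_sumr; apply: eq_bigr => s _.
rewrite linearZ [RHS]scalerA mulrC -scalerA; congr (_ *: _).
have -> : \prod_k mu (J k) = \prod_k mu (J (s k)).
  by apply: reindex_inj; exact: perm_inj.
rewrite [LHS]rmorph_prod (eq_bigr _ (fun k _ => fZ (I k) (J (s k)))).
by rewrite scaler_prod big_split.
Qed.
End Torus.

Section Regions.
Variables (F : fieldType) (q : F) (m n : nat).
Local Notation O := (Oq q m n).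
Local Notation p := (q ^+ 2).
Local Notation Z := (Z q).
Local Notation site := ('I_m * 'I_n)%type.

Definition generators (U : {set site}) (x : O) :=
  exists2 y, y \in U & x = Z y.1 y.2.
Local Notation A U := (subalg_gen (generators U)).

Definition up_set (U : {set site}) :=
  forall (i : 'I_m) (j : 'I_n) (i' : 'I_m) (j' : 'I_n),
  (i, j) \in U -> (i <= i')%N -> (j <= j')%N -> (i', j') \in U.

Lemma region_ind (U : {set site}) (S : {pred O}) : GRing.subalg_closed S ->
  (forall y, y \in U -> Z y.1 y.2 \in S) -> forall a, a \in A U -> a \in S.
Proof.
by move=> hS SZ a /asboolP; apply => // _ [y yU ->]; apply: SZ.
Qed.

Lemma region_gen (U : {set site}) i j : (i, j) \in U -> Z i j \in A U.
Proof. by move=> ijU; apply: mem_subalg_gen; exists (i, j). Qed.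

Lemma regionZ (U : {set site}) c a : a \in A U -> c *: a \in A U.
Proof. exact: rpredZ. Qed.

Lemma region_subring (U : {set site}) : subring_closed (A U).
Proof. exact: GRing.subalg_closedBM (subalg_gen_closed _). Qed.

Lemma region_subset (U V : {set site}) : U \subset V -> {subset A U <= A V}.
Proof.
move=> /subsetP UV; apply: region_ind; first exact: subalg_gen_closed.
by move=> [i j] /UV; apply: region_gen.
Qed.

Lemma torus_region (f : {lrmorphism O -> O}) (c : site -> F) (U : {set site}) :
  (forall y, f (Z y.1 y.2) = c y *: Z y.1 y.2) -> forall a, a \in A U ->
    f a \in A U.
Proof.
move=> fZ a Aa; suff : a \in [pred a | f a \in A U] by [].
have [h1 hL hM] := subalg_gen_closed (generators U).
apply: region_ind Aa; last first.
  by move=> [i j] ijU; rewrite inE fZ rpredZ // region_gen.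
split=> [|d a' b'|a' b']; rewrite !inE ?rmorph1 // ?linearP ?rmorphM.
  exact: hL.
exact: hM.
Qed.

Definition before (x y : site) := (x.1 < y.1)%N || ((x.1 == y.1) && (x.2 < y.2)%N).

Lemma first_site (U : {set site}) : U != set0 ->
  exists2 x, x \in U & forall y, y \in U -> y != x -> before x y.
Proof.
case/set0Pn => x0 x0U.
pose M := fun y : site => (y.1 * n + y.2)%N.
case: (@arg_minnP _ x0 (mem U) M x0U) => x xU xmin; exists x => // -[i j] yU.
have /= := xmin _ yU; rewrite /M /before; case: x xU {xmin} => s t xU /=.
rewrite xpair_eqE -!val_eqE /= => le_xy.
have := ltn_ord t; have := ltn_ord j; move: le_xy; nia.
Qed.

Section OneStep.
Variables (U : {set site}) (x : site).
Hypotheses (upU : up_set U) (xU : x \in U).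
Hypothesis xmin : forall y, y \in U -> y != x -> before x y.
Let V := U :\ x.
Let X := Z x.1 x.2.

Lemma up_set_step : up_set V.
Proof.
move=> i j i' j'; rewrite !inE => /andP[ijx ijU] ii' jj'.
rewrite (upU ijU) // andbT; apply: contraNneq ijx => ijE; apply: contraT => ijx.
have := xmin ijU ijx; rewrite -ijE /before /= -!val_eqE /=; lia.
Qed.

(** [tau] divides by [p] the generators in the row or in the column of [x], and
    [tau'] is its inverse. Only points south-east of [x] leave a remainder, and
    this is a product of two generators of the up-set. *)
Lemma first_site_twist : q != 0 -> exists tau tau' : {lrmorphism O -> O},
  exists la mu, [/\ forall i j, la i * mu j != 0,
    forall i j, tau (Z i j) = (la i * mu j) *: Z i j,
    forall i j, tau' (Z i j) = (la i * mu j)^-1 *: Z i j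
    & forall b, b \in A V -> b * X - X * tau b \in A V].
Proof.
move=> q0; have p0 : p != 0 by rewrite expf_neq0.
pose la (i : 'I_m) : F := if i == x.1 then p^-1 else 1.
pose mu (j : 'I_n) : F := if j == x.2 then p^-1 else 1.
have lamu0 i j : la i * mu j != 0.
  by rewrite mulf_neq0 // /la /mu; case: ifP; rewrite ?invr_eq0 ?oner_eq0.
have [tau tauZ] := torus_action q la mu.
have [tau' tauZ'] := torus_action q (fun i => (la i)^-1) (fun j => (mu j)^-1).
exists tau, tau', la, mu; split; [exact: lamu0|exact: tauZ| |].
  by move=> i j; rewrite tauZ' invfM.
move=> b.
have tauV a : a \in A V -> tau a \in A V.
  by apply: (@torus_region _ (fun y => la y.1 * mu y.2)) => y; apply: tauZ.
have [h1 hL hM] := subalg_gen_closed (generators V).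
move=> Vb; suff : b \in [pred b | (b \in A V) && (b * X - X * tau b \in A V)].
  by case/andP.
apply: region_ind Vb.
  split=> [|c a b'|a b']; rewrite !inE.
  - by rewrite h1 rmorph1 mul1r mulr1 subrr rpred0.
  - move=> /andP[Va ha] /andP[Vb hb]; rewrite hL //=.
    rewrite linearP mulrDl mulrDr -scalerAl -scalerAr opprD addrACA -scalerBr.
    exact: hL.
  - move=> /andP[Va ha] /andP[Vb hb]; rewrite hM //= rmorphM.
    have -> : a * b' * X - X * (tau a * tau b') =
        a * (b' * X - X * tau b') + (a * X - X * tau a) * tau b'.
      by rewrite mulrBr mulrBl !mulrA addrA subrK.
    by rewrite rpredD // hM // tauV.
move=> [i j] /= ijV; rewrite inE region_gen //= tauZ -scalerAr.
have [zr zc za zd] := Z_qmx q m n.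
have [ijx ijU] : (i, j) != x /\ (i, j) \in U by apply/andP; rewrite -in_setD1.
have := xmin ijU ijx; rewrite /before /X /la /mu.
have in_V (i' : 'I_m) (j' : 'I_n) : (x.1 <= i')%N -> (x.2 <= j')%N ->
    (i', j') != x -> Z i' j' \in A V.
  move=> si tj ne; apply: region_gen; rewrite !inE ne.
  by apply: upU si tj; rewrite -surjective_pairing.
have gt_neq k (a1 a2 : 'I_k) : (a1 < a2)%N -> (a2 == a1) = false.
  by move=> a12; rewrite -val_eqE /= gtn_eqF.
move: in_V; set s := x.1; set t := x.2 => in_V.
case/orP => /= [si|/andP[/eqP si tj]].
  rewrite (gt_neq _ _ _ si); case: (ltngtP t j) => [tj|tj|/val_inj tj].
  - rewrite (gt_neq _ _ _ tj) mulr1 scale1r (zd _ _ _ _ si tj) opprD addrA.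
    rewrite subrr sub0r -scaleNr; apply: regionZ.
    apply: hM; apply: in_V; [exact: leqnn|exact: ltnW| |exact: ltnW|exact: leqnn|].
      by apply: contraTneq tj => xE; rewrite /t -xE ltnn.
    by apply: contraTneq si => xE; rewrite /s -xE ltnn.
  - rewrite eq_sym (gt_neq _ _ _ tj) mulr1 scale1r (za _ _ _ _ si tj) subrr.
    exact: rpred0.
  - rewrite -tj eqxx mul1r (zc _ _ _ si) scalerA mulVf // scale1r subrr.
    exact: rpred0.
rewrite -si eqxx (gt_neq _ _ _ tj) mulr1 (zr _ _ _ tj) scalerA mulVf // scale1r.
by rewrite subrr rpred0.
Qed.

Section Fock.
Variable f : {lrmorphism O -> endo (@vacuum_neq0 F (nat * nat)%type)}.
Local Notation fock := (fock F (nat * nat)%type).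
Hypothesis fZ : forall (i : 'I_m) (j : 'I_n) (g : fock),
  (forall s t : nat, (s < i)%N || ((s == i) && (t < j)%N) -> free_of (s, t) g) ->
  f (Z i j) g = raise F (nat_of_ord i, nat_of_ord j) g.

Definition coord (y : site) : nat * nat := (nat_of_ord y.1, nat_of_ord y.2).

Definition supported (S : {set site}) (g : fock) :=
  forall z, (forall y, y \in S -> coord y != z) -> free_of z g.

(** Applying an element to the vacuum reads off its coefficients on ordered
    monomials. *)
Definition symbol (a : O) : fock := f a (@vacuum F (nat * nat)%type).

(** Elements of the region are determined by their symbols, which involve only
    the variables of the region. *)
Definition faithful (S : {set site}) := forall a, a \in A S ->
  supported S (symbol a) /\ (symbol a = 0 -> a = 0).

Lemma coord_inj : injective coord.
Proof. by move=> [i j] [i' j'] [/val_inj -> /val_inj ->]. Qed.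

Lemma raise_supported (S : {set site}) y g :
  y \in S -> supported S g -> supported S (raise F (coord y) g).
Proof.
move=> yS Sg z zS; apply: free_of_raise; last exact: Sg.
by rewrite eq_sym; apply: zS.
Qed.

Lemma raise_iter (z : nat * nat) (g : fock) k e : free_of z g ->
  iter k (raise F z) g e = if e z == k then g (upd e z 0) else 0.
Proof.
move=> zg; elim: k e => [|k IHk] e.
  have [ez|ez] := eqVneq (e z) 0%N; last exact: zg.
  by rewrite -[X in upd e z X]ez upd_id.
by rewrite iterS raiseE; case ez: (e z) => [|l] //;
  rewrite IHk upd_same upd_upd eqSS.
Qed.

Lemma first_site_action g : supported U g -> f X g = raise F (coord x) g.
Proof.
move=> Ug; apply: fZ => s t st; apply: Ug => y yU.
apply: contraTneq st => -[<- <-]; have [->|yx] := eqVneq y x.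
  by rewrite !ltnn andbF.
by have := xmin yU yx; rewrite /before -val_eqE /=; lia.
Qed.

Lemma first_site_power k g : supported U g ->
  supported U (f (X ^+ k) g) /\ f (X ^+ k) g = iter k (raise F (coord x)) g.
Proof.
move=> Ug; elim: k => [|k [IHs IHk]]; first by rewrite rmorph1 endo_oneE.
rewrite exprS rmorphM endo_mulE first_site_action // IHk; split=> //.
by rewrite -IHk; apply: raise_supported.
Qed.

Hypothesis faithV : faithful V.

Local Notation deg_lt := (deg_lt (A V) X).

Let VU : V \subset U. Proof. exact: subsetDl. Qed.

Lemma supported_subset (S S' : {set site}) g : S \subset S' ->
  supported S g -> supported S' g.
Proof. by move=> /subsetP SS' Sg z zS; apply: Sg => y /SS'; apply: zS. Qed.

Lemma symbol_free_of b : b \in A V -> free_of (coord x) (symbol b).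
Proof.
move=> Vb; apply: (faithV Vb).1 => y; rewrite !inE => /andP[yx _].
by rewrite (inj_eq coord_inj).
Qed.

Lemma symbol_mono k b e : b \in A V ->
  symbol (X ^+ k * b) e = if e (coord x) == k then symbol b (upd e (coord x) 0)
    else 0.
Proof.
move=> Vb; rewrite /symbol rmorphM endo_mulE (first_site_power k _).2.
  exact/raise_iter/symbol_free_of.
exact/(supported_subset VU)/(faithV Vb).1.
Qed.

Lemma symbolD a b : symbol (a + b) = symbol a + symbol b.
Proof. by rewrite /symbol raddfD. Qed.

Lemma symbol_deg_lt d a e : deg_lt d a -> (d <= e (coord x))%N -> symbol a e = 0.
Proof.
move=> [c cV ->] de; rewrite /symbol raddf_sum endo_sumE.
elim/big_rec: _ => // k g _ g0; rewrite fockDE g0 addr0.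
by rewrite -/(symbol _) symbol_mono // gtn_eqF // (leq_trans _ de).
Qed.

Lemma first_top_free d b a : b \in A V -> deg_lt d a -> X ^+ d * b + a = 0 -> b = 0.
Proof.
move=> Vb la ba0; apply: (faithV Vb).2; apply/funext => e.
have [ex|ex] := eqVneq (e (coord x)) 0%N; last by rewrite (symbol_free_of Vb).
have := congr1 (fun c => symbol c (upd e (coord x) d)) ba0.
rewrite symbolD fockDE symbol_mono // (symbol_deg_lt la) ?upd_same ?eqxx //.
by rewrite upd_upd -ex upd_id addr0 {2}/symbol raddf0.
Qed.

End Fock.
End OneStep.
End Regions.

(** * Induction on the up-set *)

Section RegionInduction.
Variables (F : fieldType) (q : F) (m n : nat).
Hypothesis q0 : q != 0.
Local Notation O := (Oq q m n).
Local Notation p := (q ^+ 2).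
Local Notation Z := (Z q).
Local Notation site := ('I_m * 'I_n)%type.
Local Notation A U := (subalg_gen (@generators F q m n U)).
Local Notation inA U := (fun a : O => is_true (a \in A U)).

Definition corner_box (U : {set site}) r
    (I : 'I_r.+1 -> 'I_m) (J : 'I_r.+1 -> 'I_n) :=
  [/\ consecutive I, consecutive J, (I ord0, J ord0) \in U,
      forall y, y \in U -> ~~ ((y.1 < I ord0)%N && (y.2 < J ord0)%N)
    & (I ord_max).+1 = m \/ (J ord_max).+1 = n].

Lemma box_in_region (U : {set site}) r
    (I : 'I_r.+1 -> 'I_m) (J : 'I_r.+1 -> 'I_n) k l :
  up_set U -> corner_box U I J -> (I k, J l) \in U.
Proof.
move=> upU [Icons Jcons IJU _ _]; apply: upU IJU _ _.
  by rewrite (consecutiveE k Icons) leq_addr.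
by rewrite (consecutiveE l Jcons) leq_addr.
Qed.

Lemma minor_region (U : {set site}) r (I : 'I_r -> 'I_m) (J : 'I_r -> 'I_n) :
  (forall k l, (I k, J l) \in U) -> qminor q I J \in A U.
Proof.
move=> IJU; apply: rpred_sum => s _; apply: rpredZ; apply: rpred_prod => k _.
exact: region_gen.
Qed.

Lemma normal_region (U : {set site}) (M : O) :
  (forall y, y \in U -> exists2 c, c != 0 & q_commute c M (Z y.1 y.2)) ->
  normal (inA U) M.
Proof.
move=> MZ; have [h1 hL hM] := subalg_gen_closed (@generators F q m n U).
split=> a Ua.
- suff : a \in [pred a | `[< exists2 a', a' \in A U & M * a = a' * M >]].
    by rewrite inE => /asboolP.
  apply: region_ind Ua => [|y yU]; last first.
    have [c c0 Mc] := MZ y yU; rewrite inE; apply/asboolP.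
    exists (c *: Z y.1 y.2); last by rewrite Mc scalerAl.
    by apply/regionZ/region_gen; rewrite -surjective_pairing.
  split=> [|c u v|u v]; rewrite !inE.
  - by apply/asboolP; exists 1; rewrite ?mul1r ?mulr1.
  - move=> /asboolP[u' Uu' uE] /asboolP[v' Uv' vE]; apply/asboolP.
    exists (c *: u' + v'); first exact: hL.
    by rewrite mulrDr mulrDl -scalerAr -scalerAl uE vE.
  - move=> /asboolP[u' Uu' uE] /asboolP[v' Uv' vE]; apply/asboolP.
    by exists (u' * v'); [exact: hM | rewrite mulrA uE -(mulrA u' M v) vE mulrA].
suff : a \in [pred a | `[< exists2 a', a' \in A U & a * M = M * a' >]].
  by rewrite inE => /asboolP.
apply: region_ind Ua => [|y yU]; last first.
  have [c c0 Mc] := MZ y yU; rewrite inE; apply/asboolP.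
  exists (c^-1 *: Z y.1 y.2); last by rewrite -scalerAr Mc scalerA (mulVf c0)
    scale1r.
  by apply/regionZ/region_gen; rewrite -surjective_pairing.
split=> [|c u v|u v]; rewrite !inE.
- by apply/asboolP; exists 1; rewrite ?mul1r ?mulr1.
- move=> /asboolP[u' Uu' uE] /asboolP[v' Uv' vE]; apply/asboolP.
  exists (c *: u' + v'); first exact: hL.
  by rewrite mulrDr mulrDl -scalerAr -scalerAl uE vE.
- move=> /asboolP[u' Uu' uE] /asboolP[v' Uv' vE]; apply/asboolP.
  by exists (u' * v'); [exact: hM | rewrite -(mulrA u v M) vE mulrA uE -mulrA].
Qed.

Lemma box_normal (U : {set site}) r (I : 'I_r.+1 -> 'I_m) (J : 'I_r.+1 -> 'I_n) :
  corner_box U I J -> normal (inA U) (qminor q I J).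
Proof.
move=> [Icons Jcons _ nw se]; apply: normal_region => y yU.
apply: minor_normal => //; first exact: nw.
apply/negP => /andP[Iy Jy]; have := ltn_ord y.1; have := ltn_ord y.2; lia.
Qed.

Section Step.
Variables (U : {set site}) (x : site).
Hypotheses (upU : up_set U) (xU : x \in U).
Hypothesis xmin : forall y, y \in U -> y != x -> before x y.
Let V := U :\ x.
Let X := Z x.1 x.2.
Variable f : {lrmorphism O -> endo (@vacuum_neq0 F (nat * nat)%type)}.
Local Notation fock := (fock F (nat * nat)%type).
Hypothesis fZ : forall (i : 'I_m) (j : 'I_n) (g : fock),
  (forall s t : nat, (s < i)%N || ((s == i) && (t < j)%N) -> free_of (s, t) g) ->
  f (Z i j) g = raise F (nat_of_ord i, nat_of_ord j) g.
Hypothesis faithV : faithful f V.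
Hypothesis domV : forall a b, a \in A V -> b \in A V -> a * b = 0 -> a = 0 \/ b = 0.

Variables (tau tau' : {lrmorphism O -> O}) (la : 'I_m -> F) (mu : 'I_n -> F).
Hypotheses (lamu0 : forall i j, la i * mu j != 0)
  (tauZ : forall i j, tau (Z i j) = (la i * mu j) *: Z i j)
  (tauZ' : forall i j, tau' (Z i j) = (la i * mu j)^-1 *: Z i j)
  (Vx : forall b, b \in A V -> b * X - X * tau b \in A V).

Let hV : subring_closed (A V). Proof. exact: region_subring. Qed.
Let tauV b : b \in A V -> tau b \in A V.
Proof. by apply: (@torus_region _ _ _ _ tau (fun y => la y.1 * mu y.2)) => y;
  apply: tauZ. Qed.
Let tauV' b : b \in A V -> tau' b \in A V.
Proof. by apply: (@torus_region _ _ _ _ tau' (fun y => (la y.1 * mu y.2)^-1)) =>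
  y; apply: tauZ'. Qed.
Let tauK b : b \in A V -> tau' (tau b) = b.
Proof.
move=> Vb; suff : b \in [pred b | tau' (tau b) == b] by rewrite inE => /eqP.
apply: region_ind Vb => [|y _]; last first.
  by rewrite inE tauZ linearZ /= tauZ' scalerA (mulfV (lamu0 _ _)) scale1r.
split=> [|c u v|u v]; rewrite !inE; first by rewrite !rmorph1.
  by move=> /eqP uE /eqP vE; rewrite linearP /= linearP /= uE vE.
by move=> /eqP uE /eqP vE; rewrite !rmorphM /= uE vE.
Qed.
Let tau_inj b : b \in A V -> tau b = 0 -> b = 0.
Proof. by move=> Vb tb; rewrite -(tauK Vb) tb raddf0. Qed.
Let top_free d b a : b \in A V -> deg_lt (A V) X d a -> X ^+ d * b + a = 0 -> b = 0.
Proof. exact: (first_top_free xU xmin fZ faithV). Qed.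

Lemma region_ore : inA U = ore_ext (A V) X.
Proof.
apply/funext => a; apply/propext; split=> [Ua|[d [c cV ->]]]; last first.
  apply: rpred_sum => i _; apply: rpredM;
    last exact: region_subset (subsetDl _ _) _ (cV i).
  by apply/rpredX/region_gen; rewrite -surjective_pairing.
suff : a \in [pred a | `[< ore_ext (A V) X a >]] by rewrite inE => /asboolP.
have h0 := @deg_lt_zero O (A V) X hV 0; have Oc b := @ore_const O (A V) X hV b.
have OB u v := @oreB O (A V) X hV u v.
have OM u v := @oreM O (A V) X tau hV tauV Vx u v.
have O0 : ore_ext (A V) X 0 by exists 0%N.
apply: region_ind Ua => [|y yU]; last first.
  rewrite inE; apply/asboolP; have [->|yx] := eqVneq y x; first exact: ore_x.
  by apply/Oc/region_gen; rewrite -surjective_pairing !inE yx.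
split=> [|c u v|u v]; rewrite !inE.
- by apply/asboolP/Oc; case: hV.
- move=> /asboolP Ou /asboolP Ov; apply/asboolP.
  have -> : c *: u + v = c%:A * u - (0 - v) by rewrite mulr_algl sub0r opprK.
  apply: (OB _ _ _ (OB _ _ O0 Ov)); apply: OM Ou; apply: Oc.
  by apply: regionZ; case: hV.
- by move=> /asboolP Ou /asboolP Ov; apply/asboolP; apply: OM.
Qed.

Lemma step_faithful : faithful f U.
Proof.
move=> a Ua; have [d la_] : ore_ext (A V) X a by rewrite -region_ore.
split.
  case: la_ => c cV ->; rewrite /symbol raddf_sum endo_sumE => z zU.
  elim/big_rec: _ => // k g _ gz e ez; rewrite fockDE gz // addr0.
  have := (first_site_power xU xmin fZ k (supported_subset (subsetDl U [set x])
    (faithV (cV k)).1)).1.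
  rewrite /symbol -endo_mulE -rmorphM => h; exact: h zU e ez.
elim: d a la_ {Ua} => [|d IHd] a la_ a0; first by case: la_ => c _ ->;
  rewrite big_ord0.
have [b [a1 [Vb la1 aE]]] := deg_lt_recr la_.
suff b0 : b = 0 by rewrite aE b0 mulr0 add0r; apply: IHd => //;
  rewrite aE b0 mulr0 add0r in a0.
apply: (faithV Vb).2; apply/funext => e.
have [ex|ex] := eqVneq (e (coord x)) 0%N;
  last by rewrite (symbol_free_of faithV Vb).
have := congr1 (fun g : fock => g (upd e (coord x) d)) a0.
rewrite aE symbolD fockDE (symbol_mono xU xmin fZ faithV) //.
rewrite (symbol_deg_lt xU xmin fZ faithV la1) ?upd_same ?eqxx //.
by rewrite upd_upd -ex upd_id addr0.
Qed.

Lemma step_domain a b : a \in A U -> b \in A U -> a * b = 0 -> a = 0 \/ b = 0.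
Proof.
move=> Ua Ub; have Oa : ore_ext (A V) X a by rewrite -region_ore.
have Ob : ore_ext (A V) X b by rewrite -region_ore.
by apply: (ore_domain hV tauV Vx top_free domV tau_inj).
Qed.

Lemma corner_box_step r (I : 'I_r.+1 -> 'I_m) (J : 'I_r.+1 -> 'I_n) :
  corner_box U I J -> x != (I ord0, J ord0) -> corner_box V I J.
Proof.
move=> [Icons Jcons IJU nw se] xIJ; split=> //.
  by rewrite !inE eq_sym xIJ.
by move=> y; rewrite !inE => /andP[_]; apply: nw.
Qed.

(** [tau] multiplies [M] by a scalar, so it respects divisibility by [M]. *)
Lemma step_prime_extend r (I : 'I_r.+1 -> 'I_m) (J : 'I_r.+1 -> 'I_n) :
  corner_box U I J -> x != (I ord0, J ord0) ->
  prime_element (inA V) (qminor q I J) -> prime_element (inA U) (qminor q I J).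
Proof.
move=> UIJ xIJ Vprime; have VIJ := corner_box_step UIJ xIJ.
have upV := up_set_step upU xU xmin.
have := box_normal UIJ; rewrite region_ore => Mnormal.
apply: (prime_element_extend hV tauV Vx top_free domV Mnormal _ Vprime).
  by apply: minor_region => k l; apply: box_in_region upV VIJ.
move=> b Vb [g Vg tb]; rewrite -(tauK Vb) tb rmorphM /=.
have tauZ'' i j : tau' (Z i j) = ((la i)^-1 * (mu j)^-1) *: Z i j.
  by rewrite tauZ' invfM.
pose c : F := (\prod_k (la (I k))^-1) * \prod_k (mu (J k))^-1.
rewrite (_ : tau' (qminor q I J) = c *: qminor q I J);
  last exact: (torus_minor I J tauZ'').
exists (c *: tau' g); first exact: (regionZ c (tauV' Vg)).
by rewrite -scalerAr scalerAl.
Qed.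

Lemma beheaded_corner_box r (I : 'I_r.+2 -> 'I_m) (J : 'I_r.+2 -> 'I_n) :
  corner_box U I J -> x = (I ord0, J ord0) ->
  corner_box V (beheaded I) (beheaded J).
Proof.
move=> UIJ xE; have UIJ_ k l : (I k, J l) \in U := box_in_region k l upU UIJ.
case: UIJ => Icons Jcons IJU nw se.
have I1 := consecutiveE (lift ord0 ord0) Icons;
  have J1 := consecutiveE (lift ord0 ord0) Jcons.
rewrite lift0 addn1 in I1; rewrite lift0 addn1 in J1.
split.
- by move=> k l kl; apply: Icons; rewrite !lift0 kl.
- by move=> k l kl; apply: Jcons; rewrite !lift0 kl.
- by rewrite !inE UIJ_ andbT xE xpair_eqE -val_eqE /= /beheaded I1; apply/nandP;
  left; apply/eqP; lia.
- move=> y; rewrite !inE /beheaded I1 J1 => /andP[yx yU];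
  apply/negP => /andP[h1 h2].
  have := xmin yU yx; rewrite /before xE /=.
  case/orP => [h|/andP[_ h]]; first by rewrite ltnS leqNgt h in h1.
  by rewrite ltnS leqNgt h in h2.
- by rewrite /beheaded (_ : lift ord0 (@ord_max r) = ord_max) //; apply: val_inj.
Qed.

(** The tail avoids the point [x], the only one of the box outside [V]. *)
Lemma minor_tail_region r (I : 'I_r.+1 -> 'I_m) (J : 'I_r.+1 -> 'I_n) :
  corner_box U I J -> x = (I ord0, J ord0) -> minor_tail q I J \in A V.
Proof.
move=> UIJ xE; have UIJ_ k l : (I k, J l) \in U := box_in_region k l upU UIJ.
case: UIJ => Icons Jcons IJU nw se.
apply: rpred_sum => s s0; apply: rpredZ; apply: rpred_prod => k _.
apply: region_gen; rewrite !inE UIJ_ andbT xE xpair_eqE -!val_eqE /=.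
rewrite (consecutiveE k Icons) (consecutiveE (s k) Jcons).
case: (eqVneq k ord0) => [->|k0]; last by move: k0; rewrite -val_eqE /=; lia.
by move: s0; rewrite -val_eqE /=; lia.
Qed.

Lemma step_prime_adjoin r (I : 'I_r.+1 -> 'I_m) (J : 'I_r.+1 -> 'I_n) :
  corner_box U I J -> x = (I ord0, J ord0) ->
  (forall r' (I' : 'I_r'.+1 -> 'I_m) (J' : 'I_r'.+1 -> 'I_n),
     corner_box V I' J' -> prime_element (inA V) (qminor q I' J')) ->
  prime_element (inA U) (qminor q I J).
Proof.
move=> UIJ xE Vprime.
have Mnormal : normal (ore_ext (A V) X) (qminor q I J).
  by rewrite -region_ore; apply: box_normal.
have Vtail := minor_tail_region UIJ xE.
have upV := up_set_step upU xU xmin.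
have ME : qminor q I J = X * qminor q (beheaded I) (beheaded J) + minor_tail q I J.
  by rewrite minor_expand /X xE.
rewrite region_ore.
case: r I J UIJ xE Mnormal Vtail ME => [|r] I J UIJ xE Mnormal Vtail ME.
  rewrite minor_size0 in ME.
  apply: (prime_element_adjoin hV tauV Vx top_free domV tau_inj Mnormal _ Vtail
    _ ME).
  - exact: rpred1.
  - exact: oner_neq0.
  - by split=> b Vb; exists b; rewrite ?mul1r ?mulr1.
  - exists 1; last by rewrite !mul1r mulr1.
    by apply: (ore_const _ hV); apply: rpred1.
  - by left.
have VIJ := beheaded_corner_box UIJ xE.
have Nprime := Vprime _ _ _ VIJ.
have N0 := let: And3 h _ _ := Nprime in h.
have VN : qminor q (beheaded I) (beheaded J) \in A V.
  by apply: minor_region => k l; apply: box_in_region upV VIJ.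
apply: (prime_element_adjoin hV tauV Vx top_free domV tau_inj Mnormal VN Vtail
  N0 ME).
- exact: box_normal VIJ.
- exists 1; first by apply: (ore_const _ hV); apply: rpred1.
  rewrite mul1r; case: UIJ => Icons Jcons _ _ _.
  have := minor_central q0 Icons Jcons; move: (qminor q I J) => M central.
  apply/esym; rewrite /qminor mulr_suml mulr_sumr; apply: eq_bigr => s _.
  rewrite -scalerAl -scalerAr; congr (_ *: _).
  elim/big_rec: _ => [|k u _ uE]; first by rewrite mul1r mulr1.
  by rewrite /beheaded mulrA central -mulrA uE mulrA.
right; split=> // -[g _ gE].
have [Icons Jcons _ _ _] := UIJ.
exact: (tail_not_multiple q0 Icons Jcons gE).
Qed.

End Step.

Lemma empty_region a : a \in A set0 -> exists c : F, a = c%:A.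
Proof.
move=> Aa; suff : a \in [pred a | `[< exists c : F, a = c%:A >]].
  by rewrite inE => /asboolP.
apply: region_ind Aa => [|y]; last by rewrite in_set0.
split=> [|c u v|u v]; rewrite !inE.
- by apply/asboolP; exists 1; rewrite scale1r.
- move=> /asboolP[d ->] /asboolP[d' ->]; apply/asboolP; exists (c * d + d').
  by rewrite scalerA scalerDl.
- move=> /asboolP[d ->] /asboolP[d' ->]; apply/asboolP; exists (d * d').
  by rewrite mulr_algl scalerA.
Qed.

Lemma scalar_eq0 (c : F) : c%:A = 0 :> O -> c = 0.
Proof.
by move/eqP; rewrite scaler_eq0 (negbTE (oner_neq0 O)) orbF => /eqP.
Qed.

Lemma empty_faithful (f : {lrmorphism O ->
  endo (@vacuum_neq0 F (nat * nat)%type)}) :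
  faithful f set0.
Proof.
move=> a /empty_region[c ->].
have -> : symbol f c%:A = c *: @vacuum F (nat * nat)%type.
  by rewrite /symbol linearZ rmorph1.
split=> [z _ e ez|/eqP].
  rewrite fockZE /vacuum asboolF ?mulr0 // => e0.
  by rewrite e0 eqxx in ez.
by rewrite scaler_eq0 (negbTE (vacuum_neq0 _ _)) orbF => /eqP ->; rewrite scale0r.
Qed.

Lemma empty_domain a b : a \in A set0 -> b \in A set0 -> a * b = 0 ->
  a = 0 \/ b = 0.
Proof.
move=> /empty_region[c ->] /empty_region[d ->].
rewrite mulr_algl scalerA => /scalar_eq0 /eqP; rewrite mulf_eq0.
by case/orP => /eqP ->; [left | right]; rewrite scale0r.
Qed.

Theorem region_prime (U : {set site}) r
    (I : 'I_r.+1 -> 'I_m) (J : 'I_r.+1 -> 'I_n) :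
  up_set U -> corner_box U I J -> prime_element (inA U) (qminor q I J).
Proof.
have [f fZ] := fock_module m n q0.
suff main k (W : {set site}) : (#|W| <= k)%N -> up_set W ->
    [/\ faithful f W,
      forall a b, a \in A W -> b \in A W -> a * b = 0 -> a = 0 \/ b = 0
    & forall r' (I' : 'I_r'.+1 -> 'I_m) (J' : 'I_r'.+1 -> 'I_n),
        corner_box W I' J' -> prime_element (inA W) (qminor q I' J')].
  by move=> upU UIJ; have [_ _] := main _ U (leqnn _) upU; apply.
elim: k W => [|k IHk] W cardW upW; last first.
  have [W0|W0] := eqVneq W set0; first by apply: IHk; rewrite // W0 cards0.
  have [x xW xmin] := first_site W0.
  have upV := up_set_step upW xW xmin.
  have cardV : (#|W :\ x| <= k)%N by have := cardsD1 x W; rewrite xW; lia.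
  have [faithV domV primeV] := IHk _ cardV upV.
  have [tau [tau' [la [mu [lamu0 tauZ tauZ' Vx]]]]] :=
    first_site_twist upW xW xmin q0.
  split.
  - exact: (step_faithful xW xmin fZ faithV tauZ Vx).
  - exact: (step_domain xW xmin fZ faithV domV lamu0 tauZ tauZ' Vx).
  move=> r' I' J' WIJ; have [xE|xIJ] := eqVneq x (I' ord0, J' ord0).
    exact: (step_prime_adjoin upW xW xmin fZ faithV domV lamu0 tauZ tauZ' Vx WIJ
      xE primeV).
  apply: (step_prime_extend upW xW xmin fZ faithV domV lamu0 tauZ tauZ' Vx WIJ xIJ).
  exact/primeV/corner_box_step.
have -> : W = set0 by apply/eqP; rewrite -cards_eq0 -leqn0.
split; [exact: empty_faithful | exact: empty_domain | ].
by move=> r' I' J' [_ _]; rewrite in_set0.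
Qed.
End RegionInduction.

(** * Broken lines *)

Section BrokenLine.
Variables (m n : nat) (L : {set 'I_m * 'I_n}).
Hypothesis hL : broken_line L.
Local Notation U := (below L :|: L).

Lemma mem_region (y : 'I_m * 'I_n) : reflect
  (exists2 l : 'I_m * 'I_n, l \in L &
    exists t, y.1 = (l.1 + t)%N :> nat /\ y.2 = (l.2 + t)%N :> nat)
  (y \in U).
Proof.
apply: (iffP idP) => [|[l lL [t [y1 y2]]]].
  rewrite inE => /orP[|yL]; last by exists y => //; exists 0%N; rewrite !addn0.
  rewrite inE => /andP[_ /exists_inP[l lL /existsP[t /and3P[_ /eqP y1 /eqP y2]]]].
  by exists l => //; exists t.
rewrite inE; have [yL|yL] := boolP (y \in L); rewrite ?orbT // orbF inE yL /=.
have tm : (t < m)%N by have := ltn_ord y.1; rewrite y1; lia.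
apply/exists_inP; exists l => //; apply/existsP; exists (Ordinal tm) => /=.
rewrite y1 y2 !eqxx !andbT lt0n; apply: contraNneq yL => t0.
suff -> : y = l by [].
by case: y l y1 y2 {lL} => [y1 y2] [l1 l2] /=;
  rewrite t0 !addn0 => /val_inj -> /val_inj ->.
Qed.

Lemma line_next (l : 'I_m * 'I_n) : l \in L ->
  (l.1).+1 = m \/ exists2 l' : 'I_m * 'I_n, l' \in L & unit_step l l'.
Proof.
case: hL => p [s [/(pathP p) sP _ [lm _] ->]]; rewrite inE => /(nthP p)[i].
rewrite /= ltnS leq_eqVlt => /orP[/eqP-> <-|si <-]; first by left; move: lm;
  rewrite (last_nth p).
right; exists (nth p s i); last exact: sP.
by rewrite inE in_cons mem_nth ?orbT.
Qed.

Lemma line_previous (l : 'I_m * 'I_n) : l \in L ->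
  (l.2).+1 = n \/ exists2 l' : 'I_m * 'I_n, l' \in L & unit_step l' l.
Proof.
case: hL => p [s [/(pathP p) sP [_ pn] _ ->]]; rewrite inE => /(nthP p)[[|i]].
  by move=> _ <-; left.
rewrite /= ltnS => si <-; right; exists (nth p (p :: s) i); last exact: sP.
by rewrite inE mem_nth //= ltnS ltnW.
Qed.

(** The diagonal through a lower or right neighbour is the next or the previous
    one, and the path meets it at its next or previous point. *)
Lemma region_up_set : up_set U.
Proof.
have down (i i' : 'I_m) j : i' = i.+1 :> nat -> (i, j) \in U -> (i', j) \in U.
  move=> ii' /mem_region[l lL [t [/= it jt]]]; apply/mem_region.
  have [lm|[l' l'L]] := line_next lL.
    have := leq_trans (ltn_ord i') (eq_leq (esym lm)); rewrite ii' it => h;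
      exfalso; lia.
  case/orP => /andP[/eqP h1 /eqP h2]; exists l' => //=.
    by exists t.+1; move/(congr1 (@nat_of_ord m)): h1; lia.
  by exists t; move/(congr1 (@nat_of_ord n)): h2; lia.
have right i (j j' : 'I_n) : j' = j.+1 :> nat -> (i, j) \in U -> (i, j') \in U.
  move=> jj' /mem_region[l lL [t [/= it jt]]]; apply/mem_region.
  have [ln|[l' l'L]] := line_previous lL.
    have := leq_trans (ltn_ord j') (eq_leq (esym ln)); rewrite jj' jt => h;
      exfalso; lia.
  case/orP => /andP[/eqP h1 /eqP h2]; exists l' => //=.
    by exists t; move/(congr1 (@nat_of_ord m)): h1; lia.
  by exists t.+1; move/(congr1 (@nat_of_ord n)): h2; lia.
move=> i j i' j' ijU ii' jj'.
have {ijU} i'jU : (i', j) \in U.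
  move e : (i' - i)%N => k; elim: k i' ii' e => [|k IHk] i' ii' e.
    by have -> : i' = i by apply: val_inj => /=; lia.
  have i'm : (i'.-1 < m)%N by have := ltn_ord i'; lia.
  by apply: (down (Ordinal i'm)) => /=; [lia | apply: IHk => /=; lia].
move e : (j' - j)%N => k; elim: k j' jj' e => [|k IHk] j' jj' e.
  by have -> : j' = j by apply: val_inj => /=; lia.
have j'n : (j'.-1 < n)%N by have := ltn_ord j'; lia.
by apply: (right _ (Ordinal j'n)) => /=; [lia | apply: IHk => /=; lia].
Qed.

(** A point of the up-set strictly north-west of the box would allow a bigger
    box with the same corner. *)
Lemma C_minus_corner_box (F : fieldType) (q : F) M : C_minus L M ->
  exists r (I : 'I_r.+1 -> 'I_m) (J : 'I_r.+1 -> 'I_n),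
    corner_box U I J /\ M = qminor q I J.
Proof.
case=> i [j [[|r] [I [J [ij [// _ Icons Jcons IJcorner IJU] big ->]]]]].
exists r, I, J; split=> //; have [Imax Jmax] := IJcorner ord_max erefl.
split=> //; last by rewrite Imax Jmax.
move=> y yU; apply/negP => /andP[yI yJ].
have Im : ((I ord0).-1 < m)%N by have := ltn_ord (I ord0); lia.
have Jn : ((J ord0).-1 < n)%N by have := ltn_ord (J ord0); lia.
pose I' k := if unlift ord0 k is Some k' then I k' else Ordinal Im.
pose J' k := if unlift ord0 k is Some k' then J k' else Ordinal Jn.
suff /big : solid_in_region L i j I' J' by rewrite ltnn.
have I'E k : I' k = ((I ord0).-1 + k)%N :> nat.
  rewrite /I'; case: unliftP => [k' ->|-> /=]; last by rewrite addn0.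
  by rewrite (consecutiveE k' Icons) lift0; lia.
have J'E k : J' k = ((J ord0).-1 + k)%N :> nat.
  rewrite /J'; case: unliftP => [k' ->|-> /=]; last by rewrite addn0.
  by rewrite (consecutiveE k' Jcons) lift0; lia.
split=> // [k l kl|k l kl|k kr|k l].
- by rewrite !I'E kl addnS.
- by rewrite !J'E kl addnS.
- have -> : k = lift ord0 ord_max by apply: ord_inj; rewrite lift0; case: kr.
  by rewrite /I' /J' liftK.
- case: y yU yI yJ => y1 y2 yU /= yI yJ.
  by apply: (region_up_set yU); rewrite ?I'E ?J'E; lia.
Qed.
End BrokenLine.

Theorem proposition8p6 (m n : nat) (m_gt0 : (0 < m)%N) (n_gt0 : (0 < n)%N)
  (L : {set 'I_m * 'I_n}) (hL : broken_line L)
  (M : Oq_region qvar L) (hM : C_minus L (subalg_val M)) :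
  completely_prime (ideal_gen (fun x : Oq_region qvar L => x = M)) /\
  (forall p1 p2 p3 : Oq_region qvar L, p1 * M = p2 * p3 ->
     (exists p4 : Oq_region qvar L, p2 = p4 * M) \/
     (exists p5 : Oq_region qvar L, p3 = p5 * M)).
Proof.
have q0 : qvar != 0 by rewrite tofrac_eq0 polyX_eq0.
have [r [I [J [box ME]]]] := C_minus_corner_box hL hM.
have [_ M1 Mprime] := region_prime q0 (region_up_set hL) box.
have [Mnormal _] := box_normal q0 box.
rewrite -ME in M1 Mprime Mnormal.
pose I0 : {pred Oq_region qvar L} := fun x => `[< exists y, x = y * M >].
have I0P x : reflect (exists y, x = y * M) (x \in I0) by apply: asboolP.
pose inU a := is_true (a \in subalg_gen (@generators _ qvar _ _ (below L :|: L))).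
have lift_multiple x : multiple inU (subalg_val M) (subalg_val x) ->
    exists y, x = y * M.
  move=> [g Ag xE]; exists (SubAlg Ag); apply: val_inj.
  by rewrite [RHS]rmorphM.
have ideal_I0 : two_sided_ideal I0.
  split=> [|a x|a x].
  - split=> [|x y]; first by apply/I0P; exists 0; rewrite mul0r.
    by move=> /I0P[x' ->] /I0P[y' ->]; apply/I0P; exists (x' - y'); rewrite mulrBl.
  - by move=> /I0P[x' ->]; apply/I0P; exists (a * x'); rewrite mulrA.
  - move=> /I0P[x' ->]; have [g Ag gE] := Mnormal (subalg_val a) (valP a).
    apply/I0P; exists (x' * SubAlg Ag); rewrite -!mulrA; congr (_ * _).
    by apply: val_inj; rewrite [LHS]rmorphM [RHS]rmorphM.
have ideal_genP x : (x \in ideal_gen (fun x : Oq_region qvar L => x = M))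
    = (x \in I0).
  apply/asboolP/I0P => [h|[y ->] K [_ Kl _] KM]; last by apply/Kl/KM.
  by apply/I0P; apply: h => // y ->; apply/I0P; exists 1; rewrite mul1r.
have prime x y : (x * y) \in I0 -> x \in I0 \/ y \in I0.
  move=> /I0P[z zE].
  have h : multiple inU (subalg_val M) (subalg_val x * subalg_val y).
    exists (subalg_val z); first exact: (valP z).
    by rewrite -[LHS](rmorphM val) zE [LHS](rmorphM val).
  by case: (Mprime _ _ (valP x) (valP y) h) => /lift_multiple h';
    [left | right]; apply/I0P.
split; last first.
  move=> p1 p2 p3 pE; have /prime[/I0P|/I0P] : p2 * p3 \in I0; last 2 first.
  - by left.
  - by right.
  by apply/I0P; exists p1.
split; first exact: ideal_gen_ideal.
  rewrite ideal_genP; apply/I0P => -[y yM]; apply: M1.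
  exists (subalg_val y); first exact: (valP y).
  have <- : subalg_val (1 : Oq_region qvar L) = 1 := rmorph1 val.
  by rewrite yM [LHS](rmorphM val).
by move=> x y; rewrite !ideal_genP; apply: prime.
Qed.
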